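(* Consider the Bohman–Frieze process on $n$ vertices and let $\mathrm{BF}(t)$ be the graph after $\lfloor nt/2\rfloor$ rounds. Let $t_c$ and $\bar s_2,\bar s_3,\bar s_4$ be as defined below. Then for any fixed $t\in[0,t_c)$ and $k=2,3,4$, $s_k(\mathrm{BF}(t))\to\bar s_k(t)$ in probability as $n\to\infty$.
   Context: Bohman–Frieze process: start with the empty graph on $n$ vertices; in each round, two edges $e_1=\{v_1,w_1\}$ and $e_2=\{v_2,w_2\}$ are chosen independently and uniformly at random; if both $v_1$ and $w_1$ are isolated vertices in the current graph, $e_1$ is added, otherwise $e_2$ is added. For a graph $G$ with component sizes $C_i$, $s_k(G)=\frac{1}{|G|}\sum_i C_i^k$. Let $\bar x$ solve $\bar x'=-\bar x^2-(1-\bar x^2)\bar x$, $\bar x(0)=1$ (defined and positive on $[0,\infty)$), and let $\bar s_2,\bar s_3,\bar s_4$ solve $\bar s_2'=\bar x^2+(1-\bar x^2)\bar s_2^2$, $\bar s_3'=3\bar x^2+3(1-\bar x^2)\bar s_2\bar s_3$, $\bar s_4'=7\bar x^2+(1-\bar x^2)(4\bar s_2\bar s_4+3\bar s_3^2)$ with $\bar s_2(0)=\bar s_3(0)=\bar s_4(0)=1$; $t_c\in(0,\infty)$ is the explosion time of $\bar s_2$ (so $\bar s_2(t)\to\infty$ as $t\uparrow t_c$), and these functions are defined on $[0,t_c)$. *)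

(* Defs.v *)
From mathcomp Require Import all_boot.
From Stdlib Require Import Reals.
Set Implicit Arguments. Unset Strict Implicit. Unset Printing Implicit Defensive.

(** A potential edge: an ordered pair of distinct vertices of [n] vertices.
    Choosing uniformly among ordered pairs of distinct vertices induces the
    uniform distribution on the C(n,2) unordered edges. *)
Definition edge (n : nat) := {p : 'I_n * 'I_n | p.1 != p.2}.

(** Sample space of [m] rounds: in each round the pair (e1, e2) of independent
    uniform edges.  Probability = uniform (counting) measure on this finite set. *)
Definition sample (n m : nat) := {ffun 'I_m -> edge n * edge n}.

Definition graph (n : nat) := seq ('I_n * 'I_n).

Definition isolated n (G : graph n) (v : 'I_n) : bool :=
  ~~ has (fun e : 'I_n * 'I_n => (e.1 == v) || (e.2 == v)) G.

Definition bf_step n (G : graph n) (r : edge n * edge n) : graph n :=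
  let e1 := val r.1 in let e2 := val r.2 in
  if isolated G e1.1 && isolated G e1.2 then e1 :: G else e2 :: G.

Definition BF n m (om : sample n m) : graph n :=
  foldl (@bf_step n) [::] [seq om i | i <- enum 'I_m].

Definition adj n (G : graph n) : rel 'I_n :=
  fun a b => ((a, b) \in G) || ((b, a) \in G).

Definition components n (G : graph n) : {set {set 'I_n}} :=
  [set [set w | connect (adj G) v w] | v : 'I_n].

Definition s_k n (k : nat) (G : graph n) : R :=
  (INR (\sum_(C in components G) expn #|C| k) / INR n)%R.

Definition rounds (n : nat) (t : R) : nat := Z.to_nat (Int_part (INR n * t / 2)).

Definition Rltb (a b : R) : bool := if Rlt_dec a b then true else false.

Definition Prob n m (P : pred (sample n m)) : R :=
  (INR #|[set om : sample n m | P om]| / INR #|[set: sample n m]|)%R.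

Definition conv_in_prob (k : nat) (sbar : R -> R) (t : R) : Prop :=
  forall eps : R, (0 < eps)%R ->
    Un_cv (fun n : nat =>
             Prob (fun om : sample n (rounds n t) =>
                     Rltb eps (Rabs (s_k k (BF om) - sbar t))))
          0%R.

Definition right_cont_at (f : R -> R) (a : R) : Prop :=
  forall eps : R, (0 < eps)%R -> exists d : R, (0 < d)%R /\
    forall h : R, (a <= h < a + d)%R -> (Rabs (f h - f a) < eps)%R.

(* Main.v *)
Require Import Defs.
From Stdlib Require Import Reals ZArith Lra Lia.
From HB Require Import structures.
From mathcomp Require Import all_boot zify.
Set Implicit Arguments. Unset Strict Implicit. Unset Printing Implicit Defensive.
Open Scope R_scope.

(** The vector Y = (fraction of isolated vertices, s_2, s_3, s_4) is compared with
    the ODE solution z through the squared distance D_j = |Y_j - z(2j/n)|^2.  As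
    long as D_j <= e <= 1, s_4 is bounded by some K, so the largest component M
    satisfies M^4 <= K n.  Hence the one-round drift of Y is (1/n) (g(Y) + o(1)), the
    only corrections coming from pairs inside one component (at most s_6 / n <= M^2 K / n)
    and from sampling without replacement, while the second moment of a one-round
    increment is O(M^3 / n^2) = o(1/n).  With g locally Lipschitz this gives
    E[D_{j+1} | G_j] <= (1 + 8L/n) D_j + o(1/n) inside the tube, and backward induction
    on the number of remaining rounds turns this into
    P(D_m > e) <= (1 + 8L/n)^m (D_0 + m o(1/n)) / e -> 0. *)

(** The method is a second-moment bound for a quadratic Lyapunov function, so only averages over the
    finitely many outcomes of one round occur. The obstacle is circular: drift and variance are
    controlled only while [s_4] is bounded, and [s_4] stays bounded only if the graph follows the
    ODE. The tube breaks the circle: on [[0, T]] with [T < tc] the solution is bounded by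
    compactness, and a tube of radius at most 1 adds at most 1 to that bound. This is why all four
    coordinates are followed together, even for the claim about [s_2]. The fourth moment is high
    enough to close the loop, since error terms of order M^3 / n become O(n^(-1/4)).

    The drift closes up in four coordinates for two reasons. An accepted first edge joins two
    singletons, so it raises each moment sum by a constant. When the first edge is rejected, the
    second is still uniform and merges components of sizes a and b; the gain (a+b)^(k+1) - a^(k+1) -
    b^(k+1) expands into mixed products of powers at most k, so its average over all pairs involves
    no moment beyond those already followed. *)

Lemma RplusA : associative Rplus. Proof. by move=> a b c; rewrite Rplus_assoc. Qed.
Lemma Rplus0l : left_id 0 Rplus. Proof. exact: Rplus_0_l. Qed.
HB.instance Definition _ := Monoid.isComLaw.Build R 0 Rplus RplusA Rplus_comm Rplus0l.
HB.instance Definition _ := Monoid.isMulLaw.Build R 0 Rmult Rmult_0_l Rmult_0_r.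
HB.instance Definition _ :=
  Monoid.isAddLaw.Build R Rmult Rplus Rmult_plus_distr_r Rmult_plus_distr_l.


(** * Finite sums and averages *)

Section RealSums.
Variable I : finType.
Implicit Types (P : pred I) (F G : I -> R).

Lemma rsum_le P F G : (forall i, P i -> F i <= G i) ->
  \big[Rplus/0]_(i | P i) F i <= \big[Rplus/0]_(i | P i) G i.
Proof. by move=> h; elim/big_ind2: _ => //; [lra | move=> *; lra]. Qed.

Lemma INR_sum P (f : I -> nat) :
  INR (\sum_(i | P i) f i) = \big[Rplus/0]_(i | P i) INR (f i).
Proof. by apply: (big_morph INR (op1 := Rplus)) => // a b; rewrite -plusE plus_INR. Qed.

Lemma rsum_const P (c : R) :
  \big[Rplus/0]_(i | P i) c = INR #|[pred i | P i]| * c.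
Proof.
rewrite -sum1_card INR_sum big_distrl /=.
by apply: eq_bigr => i _; rewrite Rmult_1_l.
Qed.

End RealSums.

Definition avg (T : finType) (F : T -> R) : R :=
  (\big[Rplus/0]_(r : T) F r) / INR #|T|.

Section Average.
Variable T : finType.
Hypothesis T_gt0 : (0 < #|T|)%N.
Implicit Types F G : T -> R.

Lemma cardR_gt0 : 0 < INR #|T|.
Proof. by apply: lt_0_INR; apply/ltP. Qed.

Lemma avg_le F G : (forall r, F r <= G r) -> avg F <= avg G.
Proof.
move=> h; apply: Rmult_le_compat_r.
  by apply: Rlt_le; apply: Rinv_0_lt_compat; exact: cardR_gt0.
by apply: rsum_le.
Qed.

Lemma avgD F G : avg (fun r => F r + G r) = avg F + avg G.
Proof. by rewrite /avg big_split /= /Rdiv Rmult_plus_distr_r. Qed.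

Lemma avgZ c F : avg (fun r => c * F r) = c * avg F.
Proof. by rewrite /avg -big_distrr /= /Rdiv Rmult_assoc. Qed.

Lemma avg_cst c : avg (fun _ : T => c) = c.
Proof.
rewrite /avg rsum_const (eq_card (B := T)) //.
by field; apply: Rgt_not_eq; exact: cardR_gt0.
Qed.

Lemma avg_ge0 F : (forall r, 0 <= F r) -> 0 <= avg F.
Proof. by move=> h; rewrite -(avg_cst 0); apply: avg_le. Qed.

End Average.

Lemma eq_avg (T : finType) (F G : T -> R) : F =1 G -> avg F = avg G.
Proof. by move=> h; rewrite /avg (eq_bigr G) // => i _; exact: h. Qed.

(** * Splitting a sample into its first round and the remaining ones *)

Section FfunCons.
Variables (T : finType) (k : nat).

Definition ffun_cons (p : T * {ffun 'I_k -> T}) : {ffun 'I_k.+1 -> T} :=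
  [ffun i => oapp p.2 p.1 (unlift ord0 i)].

Lemma ffun_cons_bij : bijective ffun_cons.
Proof.
exists (fun f : {ffun 'I_k.+1 -> T} => (f ord0, [ffun j => f (lift ord0 j)])).
  move=> [r f]; rewrite /= ffunE unlift_none /=; congr pair.
  by apply/ffunP=> j; rewrite !ffunE liftK.
by move=> f; apply/ffunP => i; rewrite ffunE; case: unliftP => [j ->|->] //=; rewrite ffunE.
Qed.

Lemma map_ffun_cons p :
  [seq ffun_cons p i | i <- enum 'I_k.+1] = p.1 :: [seq p.2 i | i <- enum 'I_k].
Proof.
rewrite enum_ordSl /= ffunE unlift_none /=; congr cons.
by rewrite -map_comp; apply: eq_map => j /=; rewrite ffunE liftK.
Qed.

(** Conditioning on the first draw, in counting form: [ffun_cons] is a bijection, so the samples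
    satisfying [P] are sorted by their first entry. *)
Lemma card_ffun_cons (P : pred (seq T)) :
  #|[set f : {ffun 'I_k.+1 -> T} | P [seq f i | i <- enum 'I_k.+1]]| =
  (\sum_(r : T) #|[set f : {ffun 'I_k -> T} | P (r :: [seq f i | i <- enum 'I_k])]|)%N.
Proof.
rewrite -sum1dep_card (reindex ffun_cons); last exact/onW_bij/ffun_cons_bij.
transitivity (\sum_(p : T * {ffun 'I_k -> T} | xpredT p.1 && P (p.1 :: [seq p.2 i | i <- enum 'I_k])) 1)%N.
  by apply: eq_bigl => p; rewrite map_ffun_cons.
rewrite -(pair_big_dep xpredT (fun r (f : {ffun 'I_k -> T}) => P (r :: [seq f i | i <- enum 'I_k]))
  (fun _ _ => 1%N)) /=.
by apply: eq_bigr => r _; rewrite sum1dep_card.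
Qed.

End FfunCons.

(** * Exit probability of a Markov chain with contracting drift *)

Section ChainBound.
Variables (T : finType) (S : Type) (step : S -> T -> S).
Hypothesis T_gt0 : (0 < #|T|)%N.
Variables (D : nat -> S -> R) (m : nat) (a c e : R).
Hypothesis D_ge0 : forall j G, 0 <= D j G.
Hypotheses (a_ge1 : 1 <= a) (c_ge0 : 0 <= c) (e_gt0 : 0 < e).
Hypothesis drift : forall j G, (j < m)%N -> D j G <= e ->
  avg (fun r => D j.+1 (step G r)) <= a * D j G + c.

(** Only the final distance [D m] is tested, not the whole trajectory. The state [G] is the current
    one and [k] the number of rounds still to be played, so the recursion runs on [k] with [m]
    fixed. *)
Definition exit_prob k (G : S) : R :=
  INR #|[set om : {ffun 'I_k -> T} |
          Rltb e (D m (foldl step G [seq om i | i <- enum 'I_k]))]|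
  / INR #|[set: {ffun 'I_k -> T}]|.

(** The Markov property as first-step analysis; it replaces conditional expectations and
    filtrations. *)
Lemma exit_probS k G : exit_prob k.+1 G = avg (fun r => exit_prob k (step G r)).
Proof.
rewrite /exit_prob (card_ffun_cons k (fun s => Rltb e (D m (foldl step G s)))) /= INR_sum.
rewrite !cardsT !card_ffun !card_ord expnS -multE mult_INR /avg.
set K := INR (_ ^ _).
have K0 : K <> 0 by apply: not_0_INR; apply/eqP; rewrite expn_eq0 -leqn0 leqNgt T_gt0.
have T0 : INR #|T| <> 0 by apply: Rgt_not_eq; exact: cardR_gt0.
rewrite -big_distrl /= /Rdiv Rinv_mult. ring.
Qed.

Lemma exit_prob_le1 k G : exit_prob k G <= 1.
Proof.
have h : 0 < INR #|[set: {ffun 'I_k -> T}]|.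
  by apply: lt_0_INR; apply/ltP; rewrite cardsT card_ffun expn_gt0 T_gt0.
rewrite /exit_prob; apply: (Rmult_le_reg_r _ _ _ h).
rewrite /Rdiv Rmult_assoc Rinv_l ?Rmult_1_r ?Rmult_1_l; last lra.
by apply: le_INR; apply/leP; apply: subset_leq_card; exact: subsetT.
Qed.

(* Once [D] exceeds [e] the right-hand side is at least 1, so the drift
   hypothesis is only ever invoked inside the tube. *)
Lemma exit_prob_bound k j G : (j + k = m)%N ->
  exit_prob k G <= a ^ k * (D j G + INR k * c) / e.
Proof.
have ak l : 1 <= a ^ l by apply: pow_R1_Rle.
have big l i H : e < D i H -> 1 <= a ^ l * (D i H + INR l * c) / e.
  move=> h; apply: (Rmult_le_reg_r e) => //.
  have lc : 0 <= INR l * c by apply: Rmult_le_pos => //; exact: pos_INR.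
  have ? := ak l; rewrite /Rdiv Rmult_assoc Rinv_l; last lra.
  by rewrite Rmult_1_r Rmult_1_l; nra.
elim: k j G => [|k IH] j G jk.
  rewrite addn0 in jk; subst j.
  case: (Rlt_dec e (D m G)) => h.
    by apply: Rle_trans (exit_prob_le1 _ _) _; apply: big.
  rewrite /exit_prob enum_ord0 /=.
  have -> : [set om : {ffun 'I_0 -> T} | Rltb e (D m G)] = set0.
    by apply/setP => om; rewrite !inE /Rltb; case: Rlt_dec.
  rewrite cards0 /= /Rdiv Rmult_0_l.
  apply: Rmult_le_pos; last by apply: Rlt_le; apply: Rinv_0_lt_compat.
  have := D_ge0 m G; lra.
case: (Rlt_dec e (D j G)) => h.
  by apply: Rle_trans (exit_prob_le1 _ _) _; apply: big.
have jm : (j < m)%N by rewrite -jk addnS ltnS leq_addr.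
rewrite exit_probS.
apply: (Rle_trans _ (avg (fun r => a ^ k / e * D j.+1 (step G r) + a ^ k / e * (INR k * c)))).
  apply: avg_le => // r; apply: Rle_trans (IH j.+1 _ _) _; first by rewrite addSnnS.
  by apply: Req_le; rewrite /Rdiv; ring.
rewrite avgD avgZ avg_cst //.
have {}h : D j G <= e by lra.
have := drift jm h.
set A := avg _ => hA.
have ae : 0 < a ^ k / e by apply: Rdiv_lt_0_compat => //; have := ak k; lra.
have -> : a ^ k.+1 * (D j G + INR k.+1 * c) / e =
  a ^ k / e * (a * (D j G + INR k.+1 * c)) by rewrite /= /Rdiv; ring.
rewrite -Rmult_plus_distr_l; apply: Rmult_le_compat_l; first lra.
(* What remains is a D + c + k c <= a (D + (k + 1) c), true because a >= 1. *)
rewrite S_INR; have ? := pos_INR k; have := D_ge0 j G.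
have ? : 0 <= (INR k + 1) * c by apply: Rmult_le_pos; lra.
nra.
Qed.

End ChainBound.

(** * Components after adding an edge *)

Section Components.
Variable n : nat.
Implicit Types (G : graph n) (e : 'I_n * 'I_n) (u v w : 'I_n).

Definition component G v : {set 'I_n} := [set w | connect (adj G) v w].
Definition csize G v : nat := #|component G v|.

Lemma adj_sym G : symmetric (adj G).
Proof. by move=> a b; rewrite /adj orbC. Qed.

Lemma conn_sym G u v : connect (adj G) u v = connect (adj G) v u.
Proof. exact/sym_connect_sym/adj_sym. Qed.

Lemma component_refl G v : v \in component G v.
Proof. by rewrite inE connect0. Qed.

Lemma csize_gt0 G v : (0 < csize G v)%N.
Proof. by apply/card_gt0P; exists v; apply: component_refl. Qed.

Lemma eq_component G u v : (component G u == component G v) = connect (adj G) u v.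
Proof.
apply/eqP/idP => [h|h].
  by have := component_refl G v; rewrite -h inE.
apply/setP=> w; rewrite !inE; apply/idP/idP => h'.
  by apply: connect_trans h'; rewrite conn_sym.
exact: connect_trans h'.
Qed.

Lemma csize_conn G u v : connect (adj G) u v -> csize G u = csize G v.
Proof. by rewrite -eq_component /csize => /eqP ->. Qed.

Lemma sum_comp_csize G v k : (\sum_(u in component G v) csize G u ^ k = csize G v ^ k.+1)%N.
Proof.
rewrite expnS -[in RHS]sum_nat_const; apply: eq_bigr => u; rewrite inE => h.
by rewrite (csize_conn h).
Qed.

(** A component C has |C| vertices, each carrying |C|^k. Sums over the fixed set of vertices are
    easier to follow than sums over a changing set of components. *)
Lemma sum_components G k :
  (\sum_(C in components G) #|C| ^ k.+1 = \sum_v csize G v ^ k)%N.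
Proof.
rewrite [RHS](partition_big_imset (component G)) /=.
have -> : [set component G v | v : 'I_n] = components G by [].
apply: eq_bigr => C /imsetP [v _ ->].
rewrite -/(component G v) -/(csize G v) -sum_comp_csize.
by apply: eq_bigl => u; rewrite inE eq_component conn_sym.
Qed.

Lemma isolated_cons e G u :
  isolated (e :: G) u = [&& e.1 != u, e.2 != u & isolated G u].
Proof. by rewrite /isolated /= !negb_or andbA. Qed.

Lemma isolated_conn G u v : isolated G u -> connect (adj G) u v -> v = u.
Proof.
move=> iso /connectP [[|w p] //= /andP [h _] _]; case/negP: iso; apply/hasP.
case/orP: h => h; [exists (u, w) | exists (w, u)] => //=; first by rewrite eqxx.
by rewrite eqxx orbT.
Qed.

Lemma isolated_csize G u : isolated G u -> csize G u = 1%N.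
Proof.
move=> iso; apply/eqP/cards1P; exists u; apply/setP=> v; rewrite !inE.
by apply/idP/eqP => [/isolated_conn ->|->] //; rewrite connect0.
Qed.

(** A walk can be shortened so that it crosses the new edge at most once, in one of the two
    directions. Induction on the walk: the first step is either an old edge, absorbed into the first
    connection, or the new one. *)
Lemma conn_cons e G u v :
  connect (adj (e :: G)) u v =
  [|| connect (adj G) u v, connect (adj G) u e.1 && connect (adj G) e.2 v
    | connect (adj G) u e.2 && connect (adj G) e.1 v].
Proof.
have sub a b : connect (adj G) a b -> connect (adj (e :: G)) a b.
  apply: connect_sub => {}a {}b h; apply: connect1.
  by rewrite /adj !inE; case/orP: h => ->; rewrite ?orbT.
have e12 : connect (adj (e :: G)) e.1 e.2.
  by apply: connect1; rewrite /adj inE -surjective_pairing eqxx.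
have e21 : connect (adj (e :: G)) e.2 e.1 by rewrite conn_sym.
apply/idP/idP; last first.
  case/or3P => [/sub //|/andP [/sub h1 /sub h2]|/andP [/sub h1 /sub h2]].
    exact: connect_trans (connect_trans h1 e12) h2.
  exact: connect_trans (connect_trans h1 e21) h2.
case/connectP => p; elim: p u => [|w p IH] u /=; first by move=> _ ->; rewrite connect0.
case/andP => uw wp vl; have {IH wp vl} := IH _ wp vl.
move: uw; rewrite /adj !inE -!orbA.
have tr a b c : connect (adj G) a b -> connect (adj G) b c -> connect (adj G) a c.
  exact: connect_trans.
case/or4P => [/eqP <-|h|/eqP <-|h] /=.
- by rewrite !connect0 /=; case/or3P => [->|/andP [_ ->]|->]; rewrite ?orbT.
- have {}h : connect (adj G) u w by apply: connect1; rewrite /adj h.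
  by case/or3P => [/(tr _ _ _ h) ->|/andP [/(tr _ _ _ h) -> ->]|/andP [/(tr _ _ _ h) -> ->]];
    rewrite ?orbT.
- by rewrite !connect0 /=; case/or3P => [->|->|/andP [_ ->]]; rewrite ?orbT.
- have {}h : connect (adj G) u w by apply: connect1; rewrite /adj h orbT.
  by case/or3P => [/(tr _ _ _ h) ->|/andP [/(tr _ _ _ h) -> ->]|/andP [/(tr _ _ _ h) -> ->]];
    rewrite ?orbT.
Qed.

Lemma csize_cons_same e G u :
  connect (adj G) e.1 e.2 -> csize (e :: G) u = csize G u.
Proof.
move=> h; apply: eq_card => v; rewrite !inE conn_cons.
apply/or3P/idP => [[//|/andP [h1 h2]|/andP [h1 h2]]|->]; last by constructor 1.
  exact: connect_trans (connect_trans h1 h) h2.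
by apply: connect_trans (connect_trans h1 _) h2; rewrite conn_sym.
Qed.

Lemma csize_cons_out e G u :
  ~~ connect (adj G) e.1 u -> ~~ connect (adj G) e.2 u -> csize (e :: G) u = csize G u.
Proof.
move=> /negPf h1 /negPf h2; apply: eq_card => v.
by rewrite !inE conn_cons (conn_sym _ u e.1) (conn_sym _ u e.2) h1 h2 !orbF.
Qed.

Lemma csize_cons_in e G u : ~~ connect (adj G) e.1 e.2 ->
  connect (adj G) e.1 u || connect (adj G) e.2 u ->
  csize (e :: G) u = (csize G e.1 + csize G e.2)%N.
Proof.
move=> nc h.
have dis : [disjoint component G e.1 & component G e.2].
  apply/pred0P => v /=; apply/negP => /andP []; rewrite !inE => h1 h2.
  by case/negP: nc; apply: connect_trans h1 _; rewrite conn_sym.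
have /eqP dis0 : component G e.1 :&: component G e.2 == set0 by rewrite setI_eq0.
rewrite /csize -cardsUI dis0 cards0 addn0; apply: eq_card => v; rewrite !inE conn_cons.
rewrite (conn_sym _ u e.1) (conn_sym _ u e.2).
case/orP: h => h.
  have -> : connect (adj G) u v = connect (adj G) e.1 v.
    by apply/idP/idP => h'; apply: connect_trans h'; rewrite // conn_sym.
  have -> : connect (adj G) e.2 u = false.
    apply/negP => h2; case/negP: nc; apply: connect_trans h _; by rewrite conn_sym.
  by rewrite h orbF.
have -> : connect (adj G) u v = connect (adj G) e.2 v.
  by apply/idP/idP => h'; apply: connect_trans h'; rewrite // conn_sym.
have -> : connect (adj G) e.1 u = false.
  apply/negP => h2; case/negP: nc; apply: connect_trans h2 _; by rewrite conn_sym.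
by rewrite h /= orbC.
Qed.

Definition tsum k G : nat := (\sum_v csize G v ^ k)%N.

Lemma tsum_cons_same e G k : connect (adj G) e.1 e.2 -> tsum k (e :: G) = tsum k G.
Proof. by move=> h; apply: eq_bigr => u _; rewrite csize_cons_same. Qed.

(** The a + b vertices of the merged component each carry (a + b)^k afterwards, and all other
    vertices keep their value. The lost terms stand on the left to avoid subtraction in [nat]. *)
Lemma tsum_cons_diff e G k : ~~ connect (adj G) e.1 e.2 ->
  (tsum k (e :: G) + csize G e.1 ^ k.+1 + csize G e.2 ^ k.+1 =
   tsum k G + (csize G e.1 + csize G e.2) ^ k.+1)%N.
Proof.
move=> nc.
have split F : (\sum_v F v = \sum_(v in component G e.1) F v + (\sum_(v in component G e.2) F v
   + \sum_(v | (v \notin component G e.1) && (v \notin component G e.2)) F v))%N.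
  rewrite (bigID (mem (component G e.1))) /=; congr addn.
  rewrite (bigID (mem (component G e.2))) /=; congr addn.
  apply: eq_bigl => v; rewrite !inE andbC.
  case h2 : (connect _ e.2 v) => //=; apply/negP => h1; case/negP: nc.
  by apply: connect_trans h1 _; rewrite conn_sym.
have out : (\sum_(v | (v \notin component G e.1) && (v \notin component G e.2)) csize (e :: G) v ^ k
  = \sum_(v | (v \notin component G e.1) && (v \notin component G e.2)) csize G v ^ k)%N.
  by apply: eq_bigr => v; rewrite !inE => /andP [h1 h2]; rewrite csize_cons_out.
have inn f : f = e.1 \/ f = e.2 -> (\sum_(v in component G f) csize (e :: G) v ^ k
  = csize G f * (csize G e.1 + csize G e.2) ^ k)%N.
  move=> hf; rewrite -[RHS]sum_nat_const; apply: eq_bigr => v; rewrite inE => h.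
  by rewrite csize_cons_in //; case: hf => <-; rewrite h ?orbT.
rewrite /tsum !split out !inn; [| by right | by left].
rewrite !sum_comp_csize (expnS (_ + _)) mulnDl; lia.
Qed.

End Components.

Lemma INR_expn m k : INR (m ^ k)%N = INR m ^ k.
Proof. by elim: k => //= k IH; rewrite expnS -multE mult_INR IH. Qed.

(** * Averages over random edges *)

Section EdgeAverage.
Variable n : nat.
Hypothesis n_gt1 : (1 < n)%N.
Local Notation N := (INR n).
Implicit Types F : 'I_n * 'I_n -> R.

Lemma INR_ge2 : 2 <= N.
Proof. by apply: (le_INR 2); apply/leP. Qed.

Lemma sum_offdiag F :
  \big[Rplus/0]_(p : 'I_n * 'I_n | p.1 != p.2) F p =
  \big[Rplus/0]_v \big[Rplus/0]_w F (v, w) - \big[Rplus/0]_v F (v, v).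
Proof.
transitivity (\big[Rplus/0]_(p : 'I_n * 'I_n | xpredT p.1 && (p.1 != p.2)) F (p.1, p.2)).
  by apply: eq_big => // p _; rewrite -surjective_pairing.
rewrite -(pair_big_dep xpredT (fun v w : 'I_n => v != w) (fun v w => F (v, w))) /=.
apply: (Rplus_eq_reg_r (\big[Rplus/0]_v F (v, v))).
rewrite -big_split /=.
have subK (x y : R) : x - y + y = x by ring.
rewrite subK.
apply: eq_bigr => v _; rewrite [RHS](bigD1 v) //= Rplus_comm; congr Rplus.
by apply: eq_bigl => w; rewrite eq_sym.
Qed.

Definition eavg F : R := avg (fun e : edge n => F (val e)).

Lemma sum_edge F :
  \big[Rplus/0]_(e : edge n) F (val e) = \big[Rplus/0]_(p : 'I_n * 'I_n | p.1 != p.2) F p.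
Proof. by rewrite (big_sub [pred p : 'I_n * 'I_n | p.1 != p.2] F). Qed.

Lemma card_edge : INR #|{: edge n}| = N * (N - 1).
Proof.
rewrite -(Rmult_1_r (INR _)).
transitivity (\big[Rplus/0]_(e : edge n) (fun=> 1) (val e)).
  by rewrite rsum_const.
rewrite (sum_edge (fun=> 1)) sum_offdiag /= !rsum_const !(eq_card (B := 'I_n)) // !card_ord; ring.
Qed.

Lemma edge_gt0 : (0 < #|{: edge n}|)%N.
Proof.
apply/ltP/INR_lt; rewrite card_edge /=; have := INR_ge2 => ?; nra.
Qed.

(** The unrestricted double sum factors into products of moment sums; the diagonal carries the
    correction for excluding loops. *)
Lemma eavgE F : eavg F =
  (\big[Rplus/0]_v \big[Rplus/0]_w F (v, w) - \big[Rplus/0]_v F (v, v)) / (N * (N - 1)).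
Proof. by rewrite /eavg /avg card_edge sum_edge sum_offdiag. Qed.

Lemma eq_eavg F F' : (forall p, p.1 != p.2 -> F p = F' p) -> eavg F = eavg F'.
Proof. by move=> h; apply: eq_avg => e; apply: h; exact: (valP e). Qed.

Lemma eavg_le F F' : (forall p, p.1 != p.2 -> F p <= F' p) -> eavg F <= eavg F'.
Proof. by move=> h; apply: (avg_le edge_gt0) => e; apply: h; exact: (valP e). Qed.

Lemma eavg_cst c : eavg (fun=> c) = c.
Proof. exact: (avg_cst edge_gt0). Qed.

Lemma eavgZ c F : eavg (fun p => c * F p) = c * eavg F.
Proof. exact: avgZ. Qed.

Definition b2R (b : bool) : R := if b then 1 else 0.

(** The test [b] looks at the first edge only, and the second edge is independent of it; hence after
    a rejection the added edge is still uniform, which gives the product term. *)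
Lemma avg_round (b : pred ('I_n * 'I_n)) F :
  avg (fun r : edge n * edge n => F (if b (val r.1) then val r.1 else val r.2)) =
  eavg (fun p => b2R (b p) * F p) + (1 - eavg (fun p => b2R (b p))) * eavg F.
Proof.
rewrite {1}/avg card_prod -multE mult_INR.
have E0 : INR #|{: edge n}| <> 0.
  by rewrite card_edge; have := INR_ge2 => ?; nra.
rewrite -(pair_big xpredT xpredT (fun e1 e2 : edge n =>
  F (if b (val e1) then val e1 else val e2))) /=.
transitivity (avg (fun e1 : edge n =>
  b2R (b (val e1)) * F (val e1) + (1 - b2R (b (val e1))) * eavg F)).
  rewrite {1}/avg /Rdiv Rinv_mult -Rmult_assoc big_distrl /=; congr Rmult.
  apply: eq_bigr => e1 _; rewrite /b2R; case: (b _).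
    by rewrite rsum_const (eq_card (B := {: edge n})) //; field.
  by rewrite Rmult_0_l Rplus_0_l Rminus_0_r Rmult_1_l.
rewrite avgD; congr Rplus.
rewrite (@eq_avg _ _ (fun e => eavg F + eavg F * (- 1 * b2R (b (val e))))); last by move=> e /=; ring.
rewrite avgD (avg_cst edge_gt0) avgZ avgZ -/(eavg (fun p => b2R (b p))); ring.
Qed.

Lemma round_gt0 : (0 < #|{: edge n * edge n}|)%N.
Proof. by rewrite card_prod muln_gt0 edge_gt0. Qed.

End EdgeAverage.

(** * One-round increments of the moment sums and of the number of isolated vertices *)

Section Increments.
Variable n : nat.
Hypothesis n_gt1 : (1 < n)%N.
Variable G : graph n.
Local Notation N := (INR n).
Implicit Types (e p : 'I_n * 'I_n).

Local Notation c v := (INR (csize G v)).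

Lemma INR_tsum k : INR (tsum k G) = \big[Rplus/0]_v c v ^ k.
Proof. by rewrite /tsum INR_sum; apply: eq_bigr => v _; rewrite INR_expn. Qed.

Definition iso2 p : bool := isolated G p.1 && isolated G p.2.

Lemma bf_stepE (r : edge n * edge n) :
  bf_step G r = (if iso2 (val r.1) then val r.1 else val r.2) :: G.
Proof. by rewrite /bf_step /iso2; case: ifP. Qed.

Definition merge_gain k (a b : R) : R := (a + b) ^ k.+1 - a ^ k.+1 - b ^ k.+1.

Definition tsum_inc k p : R := INR (tsum k (p :: G)) - INR (tsum k G).

Lemma tsum_incE k p : tsum_inc k p =
  if connect (adj G) p.1 p.2 then 0 else merge_gain k (c p.1) (c p.2).
Proof.
rewrite /tsum_inc; case: ifPn => h; first by rewrite tsum_cons_same //; ring.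
have /(congr1 INR) := tsum_cons_diff k h.
by rewrite -!plusE !plus_INR !INR_expn plus_INR /merge_gain; lra.
Qed.

(** Distinct isolated vertices are never connected, so two singletons merge. The values 2, 6, 14 for
    [k] = 1, 2, 3 are the coefficients of [x ^ 2] in [g2], [g3], [g4]. *)
Lemma tsum_inc_iso k p : p.1 != p.2 -> iso2 p -> tsum_inc k p = 2 ^ k.+1 - 2.
Proof.
move=> ne /andP [i1 i2]; rewrite tsum_incE; case: ifPn => h.
  by case/eqP: ne; rewrite (isolated_conn i1 h).
rewrite !isolated_csize // /merge_gain [INR 1]/= !pow1.
have -> : 1 + 1 = 2 by ring.
ring.
Qed.

(** Pairs inside one component gain nothing, so their share of the full double sum is subtracted: a
    vertex in a component of size a has a such partners, itself included, each contributing (2^(k+1)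
    - 2) a^(k+1). This gives the moment sum of order [k.+2]. The diagonal is covered by the same
    count. *)
Lemma eavg_tsum_inc k : eavg (tsum_inc k) =
  (\big[Rplus/0]_v \big[Rplus/0]_w merge_gain k (c v) (c w)
   - (2 ^ k.+1 - 2) * INR (tsum k.+2 G)) / (N * (N - 1)).
Proof.
rewrite eavgE //; congr Rdiv.
rewrite [X in _ - X]big1 => [|v _]; last by rewrite tsum_incE /= connect0.
rewrite Rminus_0_r; apply: (Rplus_eq_reg_r ((2 ^ k.+1 - 2) * INR (tsum k.+2 G))).
rewrite INR_tsum big_distrr -big_split /=.
have subK (x y : R) : x - y + y = x by ring.
rewrite subK.
apply: eq_bigr => v _.
rewrite (bigID (fun w => connect (adj G) v w)) [RHS](bigID (fun w => connect (adj G) v w)) /=.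
rewrite big1 => [|w h]; last by rewrite tsum_incE /= h.
rewrite Rplus_0_l Rplus_comm; congr Rplus; last first.
  by apply: eq_bigr => w /negPf h; rewrite tsum_incE /= h.
transitivity (\big[Rplus/0]_(w | connect (adj G) v w) merge_gain k (c v) (c v)).
  rewrite rsum_const (eq_card (B := component G v)); last by move=> w; rewrite !inE.
  rewrite -/(csize G v) /merge_gain.
  have -> : c v + c v = 2 * c v by ring.
  by rewrite Rpow_mult_distr /=; ring.
by apply: eq_bigr => w h; rewrite (csize_conn h).
Qed.

Lemma csize_ge1 v : 1 <= c v.
Proof. by apply: (le_INR 1); apply/leP; exact: csize_gt0. Qed.

(** Only an upper bound is needed here: restoring the pairs inside a component adds nonnegative
    squares. *)
Lemma eavg_tsum_inc_sq k : eavg (fun p => tsum_inc k p ^ 2) <=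
  (\big[Rplus/0]_v \big[Rplus/0]_w merge_gain k (c v) (c w) ^ 2) / (N * (N - 1)).
Proof.
rewrite eavgE //; apply: Rmult_le_compat_r.
  by apply: Rlt_le; apply: Rinv_0_lt_compat; have := INR_ge2 n_gt1 => ?; nra.
rewrite [X in _ - X]big1 => [|v _]; last by rewrite tsum_incE /= connect0 /=; ring.
rewrite Rminus_0_r; apply: rsum_le => v _; apply: rsum_le => w _.
by rewrite tsum_incE; case: ifP => _ /=; nra.
Qed.

Lemma sum_prod_pow i j : \big[Rplus/0]_v \big[Rplus/0]_w (c v ^ i * c w ^ j) =
  INR (tsum i G) * INR (tsum j G).
Proof.
rewrite !INR_tsum big_distrl /=; apply: eq_bigr => v _.
by rewrite big_distrr.
Qed.

Definition niso (H : graph n) : R := INR #|[set v | isolated H v]|.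

Lemma niso_sum H : niso H = \big[Rplus/0]_v b2R (isolated H v).
Proof.
rewrite /niso -sum1dep_card INR_sum big_mkcond /=.
by apply: eq_bigr.
Qed.

Definition iso_inc p : R := niso (p :: G) - niso G.

Lemma iso_incE p : p.1 != p.2 ->
  iso_inc p = - b2R (isolated G p.1) - b2R (isolated G p.2).
Proof.
move=> ne; rewrite /iso_inc !niso_sum.
rewrite (bigD1 p.1) //= (bigD1 p.2) /=; last by rewrite eq_sym.
rewrite [in X in _ - X](bigD1 p.1) //= [in X in _ - X](bigD1 p.2) /=; last by rewrite eq_sym.
rewrite !isolated_cons !eqxx /= andbF /=.
rewrite (eq_bigr (fun v => b2R (isolated G v))); first ring.
by move=> v /andP [h1 h2]; rewrite isolated_cons eq_sym h1 eq_sym h2.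
Qed.

Definition iso_prob : R := eavg (fun p => b2R (iso2 p)).

Lemma b2R01 b : 0 <= b2R b <= 1.
Proof. by case: b => /=; lra. Qed.

Lemma iso_prob01 : 0 <= iso_prob <= 1.
Proof.
split; first by rewrite -(eavg_cst n_gt1 0); apply: eavg_le => // p _; case: (b2R01 (iso2 p)).
by rewrite -(eavg_cst n_gt1 1); apply: eavg_le => // p _; case: (b2R01 (iso2 p)).
Qed.

Lemma iso_probE : iso_prob = niso G * (niso G - 1) / (N * (N - 1)).
Proof.
rewrite /iso_prob eavgE //; congr Rdiv; rewrite Rmult_minus_distr_l Rmult_1_r.
rewrite niso_sum; congr Rminus.
  rewrite big_distrl /=; apply: eq_bigr => v _; rewrite big_distrr /=.
  by apply: eq_bigr => w _; rewrite /iso2 /=; do 2 case: isolated => /=; ring.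
by apply: eq_bigr => v _; rewrite /iso2 /= andbb.
Qed.

Lemma eavg_iso_inc : eavg iso_inc = - 2 * niso G / N.
Proof.
rewrite (eq_eavg iso_incE) eavgE //=.
rewrite (eq_bigr (fun v => N * (- b2R (isolated G v)) + - niso G)) => [|v _]; last first.
  rewrite /Rminus big_split /= rsum_const (eq_card (B := 'I_n)) // card_ord; congr Rplus.
  rewrite niso_sum; apply: esym; apply: (big_morph Ropp (op1 := Rplus)); last ring.
  by move=> *; ring.
rewrite big_split /= rsum_const (eq_card (B := 'I_n)) // card_ord -big_distrr /=.
rewrite [X in _ - X](eq_bigr (fun v => 2 * - b2R (isolated G v))) => [|v _]; last ring.
rewrite -big_distrr /=.
have -> : \big[Rplus/0]_v - b2R (isolated G v) = - niso G.
  rewrite niso_sum; apply: esym; apply: (big_morph Ropp (op1 := Rplus)); last ring.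
  by move=> *; ring.
by have := INR_ge2 n_gt1 => ?; field; lra.
Qed.

Lemma avg_tsum_step k :
  avg (fun r => INR (tsum k (bf_step G r)) - INR (tsum k G)) =
  iso_prob * (2 ^ k.+1 - 2) + (1 - iso_prob) * eavg (tsum_inc k).
Proof.
rewrite (@eq_avg _ _ (fun r : edge n * edge n =>
  tsum_inc k (if iso2 (val r.1) then val r.1 else val r.2))); last first.
  by move=> r; rewrite bf_stepE.
rewrite avg_round //; congr Rplus.
rewrite Rmult_comm -eavgZ; apply: eq_eavg => p ne.
by rewrite /b2R; case: ifP => h; rewrite ?(tsum_inc_iso _ ne h); ring.
Qed.

Lemma avg_tsum_step_sq k :
  avg (fun r => (INR (tsum k (bf_step G r)) - INR (tsum k G)) ^ 2) <=
  (2 ^ k.+1 - 2) ^ 2 + eavg (fun p => tsum_inc k p ^ 2).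
Proof.
rewrite (@eq_avg _ _ (fun r : edge n * edge n =>
  (fun p => tsum_inc k p ^ 2) (if iso2 (val r.1) then val r.1 else val r.2))); last first.
  by move=> r; rewrite bf_stepE.
rewrite (avg_round n_gt1 iso2 (fun p => tsum_inc k p ^ 2)); apply: Rplus_le_compat.
  rewrite -(eavg_cst n_gt1 ((2 ^ k.+1 - 2) ^ 2)); apply: eavg_le => // p ne.
  rewrite /b2R; case: ifP => h; last by rewrite Rmult_0_l; exact: pow2_ge_0.
  by rewrite (tsum_inc_iso _ ne h) Rmult_1_l; exact: Rle_refl.
rewrite -/iso_prob -[X in _ <= X]Rmult_1_l; apply: Rmult_le_compat_r.
  by rewrite -(eavg_cst n_gt1 0); apply: eavg_le => // p _ /=; nra.
by have := iso_prob01; lra.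
Qed.

Lemma avg_iso_step :
  avg (fun r => niso (bf_step G r) - niso G) =
  - 2 * iso_prob + (1 - iso_prob) * (- 2 * niso G / N).
Proof.
rewrite (@eq_avg _ _ (fun r : edge n * edge n =>
  iso_inc (if iso2 (val r.1) then val r.1 else val r.2))); last first.
  by move=> r; rewrite bf_stepE.
rewrite avg_round // eavg_iso_inc; congr Rplus.
rewrite -eavgZ; apply: eq_eavg => p ne; rewrite iso_incE // /iso2.
by case: (isolated G p.1); case: (isolated G p.2); rewrite /=; ring.
Qed.

(** One edge destroys at most two isolated vertices. *)
Lemma avg_iso_step_sq : avg (fun r => (niso (bf_step G r) - niso G) ^ 2) <= 4.
Proof.
rewrite -(avg_cst (round_gt0 n_gt1) 4); apply: avg_le => [|r]; first exact: round_gt0.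
rewrite bf_stepE -/(iso_inc _).
have ne : (if iso2 (val r.1) then val r.1 else val r.2).1 !=
  (if iso2 (val r.1) then val r.1 else val r.2).2.
  by case: ifP => _; [exact: (valP r.1) | exact: (valP r.2)].
rewrite (iso_incE ne).
set b1 := b2R _; set b2 := b2R _.
have ? : 0 <= b1 <= 1 by exact: b2R01.
have ? : 0 <= b2 <= 1 by exact: b2R01.
rewrite /=; nra.
Qed.

End Increments.

(** * Drift and second moment of one round *)

Definition xfrac n (G : graph n) : R := niso G / INR n.
(* [smom k] is the paper's s_(k+1): summing over vertices costs one power. *)
Definition smom n k (G : graph n) : R := INR (tsum k G) / INR n.

Lemma s_kE n k (G : graph n) : s_k k.+1 G = smom k G.
Proof. by rewrite /s_k /smom sum_components. Qed.

(* Twice the right-hand sides of the ODEs, since one round lasts time 2/n. *)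
Definition gx (x : R) : R := - 2 * x ^ 2 - 2 * (1 - x ^ 2) * x.
Definition g2 (x a : R) : R := 2 * x ^ 2 + (1 - x ^ 2) * (2 * a ^ 2).
Definition g3 (x a b : R) : R := 6 * x ^ 2 + (1 - x ^ 2) * (6 * a * b).
Definition g4 (x a b c : R) : R :=
  14 * x ^ 2 + (1 - x ^ 2) * (8 * a * c + 6 * b ^ 2).

Section Drift.
Variable n : nat.
Hypothesis n_gt1 : (1 < n)%N.
Variable G : graph n.
Local Notation N := (INR n).
Local Notation c v := (INR (csize G v)).

(** The vertices of a largest component alone contribute M times M^3 to the third moment sum. *)
Lemma max_component : exists M, [/\ 1 <= M, forall v, c v <= M & M ^ 4 <= INR (tsum 3 G)].
Proof.
have n0 : (0 < n)%N by apply: ltnW.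
pose v0 := [arg max_(v > Ordinal n0) csize G v]%N.
have v0P v : (csize G v <= csize G v0)%N.
  by rewrite /v0; case: arg_maxnP => // i _; apply.
exists (c v0); split; first exact: csize_ge1.
  by move=> v; apply: le_INR; apply/leP.
rewrite -INR_expn; apply: le_INR; apply/leP.
rewrite -sum_comp_csize /tsum [X in (_ <= X)%N](bigID (mem (component G v0))) /=.
exact: leq_addr.
Qed.

Lemma smom_le_max M i j : (forall v, c v <= M) -> smom (i + j) G <= M ^ j * smom i G.
Proof.
move=> hM; rewrite /smom /Rdiv -Rmult_assoc; apply: Rmult_le_compat_r.
  by apply: Rlt_le; apply: Rinv_0_lt_compat; have := INR_ge2 n_gt1; lra.
rewrite !INR_tsum big_distrr /=; apply: rsum_le => v _.
rewrite -plusE pow_add Rmult_comm; apply: Rmult_le_compat_r.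
  by apply: pow_le; exact: pos_INR.
by apply: pow_incr; split; [exact: pos_INR | exact: hM].
Qed.

Lemma smom_mono i j : (i <= j)%N -> smom i G <= smom j G.
Proof.
move=> ij; rewrite /smom; apply: Rmult_le_compat_r.
  by apply: Rlt_le; apply: Rinv_0_lt_compat; have := INR_ge2 n_gt1; lra.
rewrite !INR_tsum; apply: rsum_le => v _; apply: Rle_pow; first exact: csize_ge1.
exact/leP.
Qed.

Lemma smom0 : smom 0 G = 1.
Proof.
rewrite /smom INR_tsum /= rsum_const (eq_card (B := 'I_n)) // card_ord.
by field; have := INR_ge2 n_gt1; lra.
Qed.

Lemma smom_ge1 k : 1 <= smom k G.
Proof. by rewrite -smom0; apply: smom_mono. Qed.

Lemma xfrac01 : 0 <= xfrac G <= 1.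
Proof.
have N0 : 0 < N by have := INR_ge2 n_gt1; lra.
rewrite /xfrac; split.
  by apply: Rmult_le_pos; [exact: pos_INR | apply: Rlt_le; exact: Rinv_0_lt_compat].
apply: (Rmult_le_reg_r N) => //; rewrite /Rdiv Rmult_assoc Rinv_l; last lra.
rewrite Rmult_1_r Rmult_1_l; apply: le_INR; apply/leP.
by rewrite -[X in (_ <= X)%N]card_ord; exact: max_card.
Qed.

(** The difference is exactly - x (1 - x) / (N - 1), the effect of drawing two distinct vertices. *)
Lemma iso_prob_near : Rabs (iso_prob G - xfrac G ^ 2) <= / (N - 1).
Proof.
have N2 := INR_ge2 n_gt1; have x01 := xfrac01.
rewrite iso_probE //.
have -> : niso G = xfrac G * N by rewrite /xfrac; field; lra.
set x := xfrac G in x01 *.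
have -> : x * N * (x * N - 1) / (N * (N - 1)) - x ^ 2 = - (x * (1 - x)) * / (N - 1).
  by field; lra.
have i0 : 0 < / (N - 1) by apply: Rinv_0_lt_compat; lra.
rewrite Rabs_mult Rabs_Ropp !Rabs_pos_eq; [nra | lra | nra].
Qed.

(** Here [q] is the mean-field gain from one uniform edge, supplied through the double sum of
    [merge_gain]. The error splits into (p - x^2)(g - q), from the acceptance probability p, and (1
    - p)(q - g t) / (N - 1), where g = 2^(k+1) - 2 and t = [smom k.+2 G] comes from pairs inside a
    component. The bound 14 serves twice: g is at most 14, and the coefficients of each [q] in use
    sum to at most 14. *)
Lemma drift_error k q K M :
  (k <= 3)%N -> 1 <= M -> (forall v, c v <= M) -> smom 3 G <= K -> 0 <= q <= 14 * K ^ 2 ->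
  \big[Rplus/0]_v \big[Rplus/0]_w merge_gain k (c v) (c w) = q * N ^ 2 ->
  Rabs (N * avg (fun r => smom k (bf_step G r) - smom k G) -
        ((2 ^ k.+1 - 2) * xfrac G ^ 2 + (1 - xfrac G ^ 2) * q))
    <= 56 * K ^ 2 * (M ^ 3 / (N - 1)).
Proof.
move=> k3 M1 hM hK hq hsum; have N2 := INR_ge2 n_gt1.
have K1 : 1 <= K by apply: Rle_trans (smom_ge1 3) hK.
rewrite (@eq_avg _ _ (fun r => / N * (INR (tsum k (bf_step G r)) - INR (tsum k G)))); last first.
  by move=> r; rewrite /smom; field; lra.
rewrite avgZ avg_tsum_step // eavg_tsum_inc // hsum -Rmult_assoc Rinv_r; last lra.
rewrite Rmult_1_l.
have -> : INR (tsum k.+2 G) = smom k.+2 G * N by rewrite /smom; field; lra.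
have ht0 : 1 <= smom k.+2 G := smom_ge1 _.
(* The bound M^2 K is weakened to M^3 K so that drift and variance share the rate M^3 / (N - 1). *)
have ht : smom k.+2 G <= M ^ 3 * K.
  have h1 : smom k.+2 G <= smom (3 + 2) G by apply: smom_mono; rewrite addn2 !ltnS.
  have h2 := smom_le_max 3 2 hM.
  have h3 : M ^ 2 * smom 3 G <= M ^ 3 * K.
    apply: Rmult_le_compat => //; [by apply: pow_le; lra | by have := smom_ge1 3; lra |].
    by apply: Rle_pow => //; apply/leP.
  lra.
have hg : 0 <= 2 ^ k.+1 - 2 <= 14.
  by case: k k3 {hsum ht0 ht} => [|[|[|[|k]]]] // _ /=; lra.
have hp := iso_prob_near; have p01 := iso_prob01 n_gt1 G.
move: (smom k.+2 G) (2 ^ k.+1 - 2) (iso_prob G) (xfrac G ^ 2) ht0 ht hg hp p01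
  => t g p y ht0 ht hg hp p01.
have i0 : 0 < / (N - 1) by apply: Rinv_0_lt_compat; lra.
have -> : p * g + (1 - p) * ((q * N ^ 2 - g * (t * N)) / (N * (N - 1))) - (g * y + (1 - y) * q)
  = (p - y) * (g - q) + (1 - p) * ((q - g * t) * / (N - 1)) by field; lra.
have M3 : 1 <= M ^ 3 by apply: pow_R1_Rle.
have K2 : K <= K ^ 2 by nra.
apply: Rle_trans (Rabs_triang _ _) _.
rewrite !Rabs_mult (Rabs_pos_eq (/ _)) ?(Rabs_pos_eq (1 - p)); [|lra|lra].
have h1 : Rabs (g - q) <= 14 * K ^ 2 by apply: Rabs_le; nra.
have h2 : Rabs (q - g * t) <= 14 * K ^ 2 + 14 * (M ^ 3 * K) by apply: Rabs_le; nra.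
have h3 : Rabs (p - y) * Rabs (g - q) <= / (N - 1) * (14 * K ^ 2).
  by apply: Rmult_le_compat => //; exact: Rabs_pos.
have h4 : (1 - p) * (Rabs (q - g * t) * / (N - 1)) <=
  1 * ((14 * K ^ 2 + 14 * (M ^ 3 * K)) * / (N - 1)).
  apply: Rmult_le_compat; [lra | | lra |].
    by apply: Rmult_le_pos; [exact: Rabs_pos | lra].
  by apply: Rmult_le_compat_r => //; lra.
have h5 : 28 * K ^ 2 + 14 * (M ^ 3 * K) <= 56 * K ^ 2 * M ^ 3 by nra.
have h6 := Rmult_le_compat_r _ _ _ (Rlt_le _ _ i0) h5.
rewrite /Rdiv; lra.
Qed.

(** From 2 a b <= a^2 + b^2 the gain is at most 7 a b (a^2 + b^2); the case k = 3 fixes the 7, and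
    a, b >= 1 brings the lower orders under it. Squaring with (a^2 + b^2)^2 <= 2 (a^4 + b^4) gives
    98 = 49 * 2 and separates the variables, so the double sum factors. *)
Lemma merge_gain_bound k a b : (0 < k <= 3)%N -> 1 <= a -> 1 <= b ->
  merge_gain k a b ^ 2 <= 98 * (a ^ 6 * b ^ 2 + a ^ 2 * b ^ 6).
Proof.
move=> hk a1 b1.
have ab : 1 <= a * b by nra.
have h : 0 <= merge_gain k a b <= 7 * (a * b) * (a ^ 2 + b ^ 2).
  have s2 : 2 * (a * b) <= a ^ 2 + b ^ 2 by have := pow2_ge_0 (a - b); lra.
  case: k hk => [|[|[|[|k]]]] // _; rewrite /merge_gain.
  - have -> : (a + b) ^ 2 - a ^ 2 - b ^ 2 = 2 * (a * b) by ring.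
    by move: (a ^ 2 + b ^ 2) (a * b) ab s2 => *; nra.
  - have -> : (a + b) ^ 3 - a ^ 3 - b ^ 3 = 3 * (a * b) * (a + b) by ring.
    have h1 : 0 <= a + b <= a ^ 2 + b ^ 2 by nra.
    by move: (a ^ 2 + b ^ 2) (a * b) (a + b) ab s2 h1 => *; nra.
  have -> : (a + b) ^ 4 - a ^ 4 - b ^ 4 = (a * b) * (4 * (a ^ 2 + b ^ 2) + 6 * (a * b)) by ring.
  by move: (a ^ 2 + b ^ 2) (a * b) ab s2 => *; nra.
have h2 : merge_gain k a b ^ 2 <= (7 * (a * b) * (a ^ 2 + b ^ 2)) ^ 2.
  by apply: pow_incr.
apply: Rle_trans h2 _.
have -> : 98 * (a ^ 6 * b ^ 2 + a ^ 2 * b ^ 6) =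
  (7 * (a * b) * (a ^ 2 + b ^ 2)) ^ 2 + 49 * (a * b) ^ 2 * (a ^ 2 - b ^ 2) ^ 2 by ring.
have : 0 <= (a * b) ^ 2 * (a ^ 2 - b ^ 2) ^ 2 by apply: Rmult_le_pos; exact: pow2_ge_0.
lra.
Qed.

(** The squared gains sum to order N^2 times [smom 6 G] times [smom 2 G], and three of the six
    powers are traded for M^3. *)
Lemma variance_error k K M :
  (0 < k <= 3)%N -> 1 <= M -> (forall v, c v <= M) -> smom 3 G <= K ->
  N * avg (fun r => (smom k (bf_step G r) - smom k G) ^ 2)
    <= 588 * K ^ 2 * (M ^ 3 / (N - 1)).
Proof.
move=> k3 M1 hM hK; have N2 := INR_ge2 n_gt1.
have K1 : 1 <= K by apply: Rle_trans (smom_ge1 3) hK.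
rewrite (@eq_avg _ _ (fun r => / N ^ 2 * (INR (tsum k (bf_step G r)) - INR (tsum k G)) ^ 2));
  last by move=> r; rewrite /smom; field; lra.
rewrite avgZ.
have h1 := avg_tsum_step_sq n_gt1 G k.
have h2 := eavg_tsum_inc_sq n_gt1 G k.
have h3 : \big[Rplus/0]_v \big[Rplus/0]_w merge_gain k (c v) (c w) ^ 2 <=
  98 * (INR (tsum 6 G) * INR (tsum 2 G) + INR (tsum 2 G) * INR (tsum 6 G)).
  rewrite -!sum_prod_pow -big_split /= big_distrr /=; apply: rsum_le => v _.
  rewrite -big_split /= big_distrr /=; apply: rsum_le => w _.
  by apply: merge_gain_bound => //; exact: csize_ge1.
have h4 : smom 6 G <= M ^ 3 * K.
  apply: Rle_trans (smom_le_max 3 3 hM) _; apply: Rmult_le_compat_l => //.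
  by apply: pow_le; lra.
have h5 : smom 2 G <= K by apply: Rle_trans hK; exact: smom_mono.
have t6 : INR (tsum 6 G) = smom 6 G * N by rewrite /smom; field; lra.
have t2 : INR (tsum 2 G) = smom 2 G * N by rewrite /smom; field; lra.
have hg : 0 <= 2 ^ k.+1 - 2 <= 14.
  by case: k k3 {h1 h2 h3} => [|[|[|[|k]]]] // _ /=; lra.
have hg2 : (2 ^ k.+1 - 2) ^ 2 <= 196 by nra.
have M3 : 1 <= M ^ 3 by apply: pow_R1_Rle.
have h6 : smom 6 G * smom 2 G <= M ^ 3 * K * K.
  have := smom_ge1 6; have := smom_ge1 2 => ? ?.
  by apply: Rmult_le_compat => //; lra.
have h7 : avg (fun r => (INR (tsum k (bf_step G r)) - INR (tsum k G)) ^ 2) <=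
  196 + 196 * (M ^ 3 * K ^ 2) * (N / (N - 1)).
  apply: Rle_trans h1 _; apply: Rplus_le_compat => //; apply: Rle_trans h2 _.
  have i0 : 0 < / (N * (N - 1)) by apply: Rinv_0_lt_compat; nra.
  apply: Rle_trans (Rmult_le_compat_r _ _ _ (Rlt_le _ _ i0) h3) _.
  rewrite t6 t2.
  have -> : 98 * (smom 6 G * N * (smom 2 G * N) + smom 2 G * N * (smom 6 G * N)) * / (N * (N - 1))
    = 196 * (smom 6 G * smom 2 G) * (N / (N - 1)) by field; lra.
  apply: Rmult_le_compat_r; last lra.
  by apply: Rlt_le; apply: Rdiv_lt_0_compat; lra.
have h8 : N / (N - 1) <= 2.
  apply: (Rmult_le_reg_r (N - 1)); first lra.
  by rewrite /Rdiv Rmult_assoc Rinv_l; lra.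
have MK : 1 <= M ^ 3 * K ^ 2 by nra.
set A := avg _ in h7 *.
(* 588 = 196 + 2 * 196: the squared gain 14^2 of an isolated pair, plus 2 * 98 from the uniform edge
   doubled by N / (N - 1) <= 2. *)
have h9 : A <= 588 * (M ^ 3 * K ^ 2) by nra.
have -> : N * (/ N ^ 2 * A) = A * / N by field; lra.
have h10 : / N <= / (N - 1) by apply: Rinv_le_contravar; lra.
have i1 : 0 < / N by apply: Rinv_0_lt_compat; lra.
have -> : 588 * K ^ 2 * (M ^ 3 / (N - 1)) = 588 * (M ^ 3 * K ^ 2) * / (N - 1).
  by rewrite /Rdiv; ring.
apply: Rle_trans (Rmult_le_compat_r _ _ _ (Rlt_le _ _ i1) h9) _.
apply: Rmult_le_compat_l => //; lra.
Qed.

(** A uniform edge removes exactly 2 x isolated vertices on average, so the only error is that of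
    [iso_prob], multiplied by - 2 (1 - x). *)
Lemma xfrac_drift_error :
  Rabs (N * avg (fun r => xfrac (bf_step G r) - xfrac G) - gx (xfrac G)) <= 2 / (N - 1).
Proof.
have N2 := INR_ge2 n_gt1.
rewrite (@eq_avg _ _ (fun r => / N * (niso (bf_step G r) - niso G))); last first.
  by move=> r; rewrite /xfrac; field; lra.
rewrite avgZ avg_iso_step //.
have -> : niso G = xfrac G * N by rewrite /xfrac; field; lra.
have hp := iso_prob_near; have x01 := xfrac01.
rewrite /gx; move: (iso_prob G) (xfrac G) hp x01 => p x hp x01.
have -> : N * (/ N * (-2 * p + (1 - p) * (-2 * (x * N) / N))) -
   (-2 * x ^ 2 - 2 * (1 - x ^ 2) * x) = (p - x ^ 2) * (- 2 * (1 - x)) by field; lra.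
rewrite Rabs_mult; have -> : 2 / (N - 1) = / (N - 1) * 2 by rewrite /Rdiv; ring.
apply: Rmult_le_compat => //; try exact: Rabs_pos.
by apply: Rabs_le; lra.
Qed.

Lemma xfrac_variance_error :
  N * avg (fun r => (xfrac (bf_step G r) - xfrac G) ^ 2) <= 4 / (N - 1).
Proof.
have N2 := INR_ge2 n_gt1.
rewrite (@eq_avg _ _ (fun r => / N ^ 2 * (niso (bf_step G r) - niso G) ^ 2)); last first.
  by move=> r; rewrite /xfrac; field; lra.
rewrite avgZ; have := avg_iso_step_sq n_gt1 G; set A := avg _ => hA.
have -> : N * (/ N ^ 2 * A) = A * / N by field; lra.
have h10 : / N <= / (N - 1) by apply: Rinv_le_contravar; lra.
have i1 : 0 < / N by apply: Rinv_0_lt_compat; lra.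
rewrite /Rdiv; nra.
Qed.

(** This and the next two results expand the binomial; its mixed terms, summed over all pairs, are
    the quadratic parts of [g2], [g3] and [g4]. *)
Lemma merge_gain1_sum :
  \big[Rplus/0]_v \big[Rplus/0]_w merge_gain 1 (c v) (c w) = 2 * smom 1 G ^ 2 * N ^ 2.
Proof.
rewrite (_ : 2 * smom 1 G ^ 2 * N ^ 2 = 2 * (INR (tsum 1 G) * INR (tsum 1 G))); last first.
  by rewrite /smom; field; have := INR_ge2 n_gt1; lra.
rewrite -sum_prod_pow big_distrr /=; apply: eq_bigr => v _.
by rewrite big_distrr /=; apply: eq_bigr => w _; rewrite /merge_gain; ring.
Qed.

Lemma merge_gain2_sum :
  \big[Rplus/0]_v \big[Rplus/0]_w merge_gain 2 (c v) (c w) =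
  6 * smom 1 G * smom 2 G * N ^ 2.
Proof.
rewrite (_ : 6 * smom 1 G * smom 2 G * N ^ 2 = 3 * (INR (tsum 2 G) * INR (tsum 1 G))
  + 3 * (INR (tsum 1 G) * INR (tsum 2 G))); last first.
  by rewrite /smom; field; have := INR_ge2 n_gt1; lra.
rewrite -!sum_prod_pow !big_distrr -big_split /=; apply: eq_bigr => v _.
by rewrite !big_distrr -big_split /=; apply: eq_bigr => w _; rewrite /merge_gain; ring.
Qed.

Lemma merge_gain3_sum :
  \big[Rplus/0]_v \big[Rplus/0]_w merge_gain 3 (c v) (c w) =
  (8 * smom 1 G * smom 3 G + 6 * smom 2 G ^ 2) * N ^ 2.
Proof.
rewrite (_ : (8 * smom 1 G * smom 3 G + 6 * smom 2 G ^ 2) * N ^ 2 =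
  4 * (INR (tsum 3 G) * INR (tsum 1 G)) + (6 * (INR (tsum 2 G) * INR (tsum 2 G))
  + 4 * (INR (tsum 1 G) * INR (tsum 3 G)))); last first.
  by rewrite /smom; field; have := INR_ge2 n_gt1; lra.
rewrite -!sum_prod_pow !big_distrr -!big_split /=; apply: eq_bigr => v _.
by rewrite !big_distrr -!big_split /=; apply: eq_bigr => w _; rewrite /merge_gain; ring.
Qed.

End Drift.

(** The second moment is scaled by n, not n^2: fluctuations then add up to O(eta) over the order n
    rounds. *)
Definition drift_ok n (Y : graph n -> R) (G : graph n) (g eta : R) : Prop :=
  Rabs (INR n * avg (fun r => Y (bf_step G r) - Y G) - g) <= eta /\
  INR n * avg (fun r => (Y (bf_step G r) - Y G) ^ 2) <= eta.

(** The threshold depends on [K] and [eta] alone. The estimates hold for every graph with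
    [smom 3 G <= K], whatever its history, as the recursion over states requires. *)
Lemma drift_all (K eta : R) : 1 <= K -> 0 < eta ->
  exists N0 : nat, forall n (G : graph n), (N0 <= n)%N -> smom 3 G <= K ->
  [/\ drift_ok (@xfrac n) G (gx (xfrac G)) eta,
      drift_ok (@smom n 1) G (g2 (xfrac G) (smom 1 G)) eta,
      drift_ok (@smom n 2) G (g3 (xfrac G) (smom 1 G) (smom 2 G)) eta &
      drift_ok (@smom n 3) G (g4 (xfrac G) (smom 1 G) (smom 2 G) (smom 3 G)) eta].
Proof.
move=> K1 eta0.
(* 588 K^2 is the largest of the error constants, so rho <= th settles all of them. *)
pose th := eta / (588 * K ^ 2).
have K20 : 1 <= K ^ 2 by nra.
have th0 : 0 < th by apply: Rdiv_lt_0_compat; lra.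
(* If rho > th, then M^3 >= th n / 2 while M^4 <= K n; comparing M^12 computed both ways forces n <=
   16 K^3 / th^4. The 2 ensures n - 1 >= n / 2. *)
have [N0 hN0] := INR_unbounded (16 * K ^ 3 / th ^ 4 + 2).
exists N0 => n G nN0 hK.
have Nbig : 16 * K ^ 3 / th ^ 4 + 2 < INR n.
  by apply: Rlt_le_trans hN0 _; apply: le_INR; apply/leP.
have th4 : 0 < th ^ 4 by apply: pow_lt.
have q0 : 0 < 16 * K ^ 3 / th ^ 4.
  by apply: Rdiv_lt_0_compat => //; have := pow_lt K 3; lra.
have n_gt1 : (1 < n)%N by apply/ltP/INR_lt => /=; lra.
have [M [M1 hM M4]] := max_component n_gt1 G.
pose rho := M ^ 3 / (INR n - 1).
have M40 : M ^ 4 <= INR n * K.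
  apply: Rle_trans M4 _; have -> : INR (tsum 3 G) = INR n * smom 3 G.
    by rewrite /smom; field; lra.
  by apply: Rmult_le_compat_l => //; lra.
have rho_le : rho <= th.
  case: (Rle_lt_dec rho th) => // h; exfalso.
  have h1 : th * (INR n - 1) < M ^ 3.
    have := Rmult_lt_compat_r (INR n - 1) _ _ _ h; rewrite /rho /Rdiv.
    by rewrite Rmult_assoc Rinv_l; lra.
  have h2 : th * (INR n / 2) <= M ^ 3.
    by apply: Rle_trans (Rlt_le _ _ h1); apply: Rmult_le_compat_l; lra.
  have h3 : (th * (INR n / 2)) ^ 4 <= (M ^ 3) ^ 4.
    by apply: pow_incr; split => //; apply: Rmult_le_pos; lra.
  have h4 : (M ^ 4) ^ 3 <= (INR n * K) ^ 3.
    by apply: pow_incr; split => //; apply: pow_le; lra.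
  have h5 : (th * (INR n / 2)) ^ 4 = th ^ 4 / 16 * INR n * INR n ^ 3 by field.
  have h6 : (M ^ 3) ^ 4 = (M ^ 4) ^ 3 by ring.
  have h7 : th ^ 4 / 16 * INR n * INR n ^ 3 <= K ^ 3 * INR n ^ 3.
    by rewrite -h5; apply: Rle_trans h3 _; rewrite h6; apply: Rle_trans h4 _; rewrite Rpow_mult_distr; lra.
  have n3 : 0 < INR n ^ 3 by apply: pow_lt; lra.
  have h8 := Rmult_le_reg_r _ _ _ n3 h7.
  have h9 : 16 * K ^ 3 / th ^ 4 * (th ^ 4 / 16) < INR n * (th ^ 4 / 16).
    by apply: Rmult_lt_compat_r; lra.
  have h10 : 16 * K ^ 3 / th ^ 4 * (th ^ 4 / 16) = K ^ 3 by field; lra.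
  lra.
have i0 : 0 < / (INR n - 1) by apply: Rinv_0_lt_compat; lra.
have M3 : 1 <= M ^ 3 by apply: pow_R1_Rle.
have irho : / (INR n - 1) <= rho by rewrite /rho /Rdiv; nra.
have e588 : 588 * K ^ 2 * rho <= eta.
  have -> : eta = 588 * K ^ 2 * th by rewrite /th; field; lra.
  by apply: Rmult_le_compat_l => //; lra.
have rho0 : 0 < rho by lra.
have e56 : 56 * K ^ 2 * rho <= eta by nra.
have e4 : 4 * / (INR n - 1) <= eta by nra.
have s1 := smom_ge1 n_gt1 G 1; have s12 := @smom_mono n n_gt1 G 1 2 isT.
have s23 := @smom_mono n n_gt1 G 2 3 isT.
have mm (a b : R) : 0 <= a <= K -> 0 <= b <= K -> 0 <= a * b <= K ^ 2 by nra.
have p11 := mm (smom 1 G) (smom 1 G); have p12 := mm (smom 1 G) (smom 2 G).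
have p13 := mm (smom 1 G) (smom 3 G); have p22 := mm (smom 2 G) (smom 2 G).
split; split.
- by apply: Rle_trans (xfrac_drift_error n_gt1 G) _; rewrite /Rdiv; lra.
- exact: Rle_trans (xfrac_variance_error n_gt1 G) _.
- apply: Rle_trans e56; rewrite /g2.
  have -> : 2 * xfrac G ^ 2 = (2 ^ 2 - 2) * xfrac G ^ 2 by ring.
  by apply: (drift_error n_gt1 _ M1 hM hK); [| nra | exact: merge_gain1_sum].
- by apply: Rle_trans e588; apply: (variance_error n_gt1 _ M1 hM hK).
- apply: Rle_trans e56; rewrite /g3.
  have -> : 6 * xfrac G ^ 2 = (2 ^ 3 - 2) * xfrac G ^ 2 by ring.
  by apply: (drift_error n_gt1 _ M1 hM hK); [| nra | exact: merge_gain2_sum].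
- by apply: Rle_trans e588; apply: (variance_error n_gt1 _ M1 hM hK).
- apply: Rle_trans e56; rewrite /g4.
  have -> : 14 * xfrac G ^ 2 = (2 ^ 4 - 2) * xfrac G ^ 2 by ring.
  by apply: (drift_error n_gt1 _ M1 hM hK); [| nra | exact: merge_gain3_sum].
- by apply: Rle_trans e588; apply: (variance_error n_gt1 _ M1 hM hK).
Qed.

(** * The differential equations *)

Section RightSolution.
Variables (f f' : R -> R) (tc : R).
Hypothesis f_right : right_cont_at f 0.
Hypothesis f_der : forall t, 0 < t < tc -> derivable_pt_lim f t (f' t).

(* Constant extension to negative times makes one-sided continuity at 0 two-sided. *)
Let clip t := f (Rmax 0 t).

Lemma clip_der t : 0 < t < tc -> derivable_pt_lim clip t (f' t).
Proof.
move=> ht; apply: (@derivable_pt_lim_locally_ext f clip t 0 tc) => //; last exact: f_der.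
by move=> z hz; rewrite /clip Rmax_right //; lra.
Qed.

Lemma clip_cont t : 0 <= t < tc -> continuity_pt clip t.
Proof.
move=> [[t0|<-] htc].
  by apply: derivable_continuous_pt; exists (f' t); apply: clip_der.
move=> eps eps0; have [d [d0 hd]] := f_right eps0.
exists d; split => // z [_]; rewrite /dist /= /R_dist => hz.
rewrite /clip (Rmax_left 0 0); last lra.
apply: hd; split; first exact: Rmax_l.
by have /Rabs_def2 [? ?] := hz; apply: Rmax_lub_lt; lra.
Qed.

(** The left end may be 0, where the first round starts and no derivative is given; the mean value
    theorem asks only for continuity there. *)
Lemma sol_mvt s t : 0 <= s < t -> t < tc ->
  exists xi, s < xi < t /\ f t - f s = f' xi * (t - s).
Proof.
move=> [s0 st] ttc.
have pr1 u : s < u < t -> derivable_pt clip u.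
  by move=> hu; exists (f' u); apply: clip_der; lra.
have [xi [hxi e]] := MVT clip id s t pr1 (fun u _ => derivable_pt_id u) st
  (fun u (hu : s <= u <= t) => clip_cont (conj (Rle_trans _ _ _ s0 (proj1 hu))
     (Rle_lt_trans _ _ _ (proj2 hu) ttc)))
  (fun u _ => derivable_continuous_pt _ _ (derivable_pt_id u)).
exists xi; split => //; move: e.
rewrite (derive_pt_eq_0 _ _ _ _ (derivable_pt_lim_id xi)).
rewrite (derive_pt_eq_0 _ _ (f' xi)); last by apply: clip_der; lra.
by rewrite /clip !Rmax_right /id; lra.
Qed.

Lemma sol_bounded T : 0 <= T < tc -> exists B, forall t, 0 <= t <= T -> Rabs (f t) <= B.
Proof.
move=> hT.
have hc u : 0 <= u <= T -> continuity_pt clip u by move=> hu; apply: clip_cont; lra.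
have [u [hu _]] := continuity_ab_maj clip 0 T (proj1 hT) hc.
have [l [hl _]] := continuity_ab_min clip 0 T (proj1 hT) hc.
exists (Rabs (clip u) + Rabs (clip l)) => t ht.
have := hu t ht; have := hl t ht; rewrite {2 3}/clip Rmax_right; last lra.
move=> h1 h2; have := Rle_abs (clip u); have := Rle_abs (- clip l); rewrite Rabs_Ropp.
have := Rabs_pos (clip u); have := Rabs_pos (clip l) => ? ? ? ?.
by apply: Rabs_le; lra.
Qed.

End RightSolution.

(* Bundling the bounds with the Lipschitz estimate makes the relation stable under
   ring operations, with constants depending only on those of the arguments. *)
Definition near (C d u v : R) : Prop := [/\ Rabs u <= C, Rabs v <= C & Rabs (u - v) <= C * d].

Lemma near_le C C' d u v : 0 <= d -> C <= C' -> near C d u v -> near C' d u v.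
Proof. by move=> d0 CC [h1 h2 h3]; split; nra. Qed.

Lemma near_add C C' d u v u' v' :
  near C d u v -> near C' d u' v' -> near (C + C') d (u + u') (v + v').
Proof.
move=> [h1 h2 h3] [h1' h2' h3']; split.
- by have := Rabs_triang u u'; lra.
- by have := Rabs_triang v v'; lra.
have -> : u + u' - (v + v') = (u - v) + (u' - v') by ring.
by have := Rabs_triang (u - v) (u' - v'); lra.
Qed.

Lemma near_mul C C' d u v u' v' : 0 <= d ->
  near C d u v -> near C' d u' v' -> near (2 * (C * C')) d (u * u') (v * v').
Proof.
move=> d0 [h1 h2 h3] [h1' h2' h3'].
have p1 := Rabs_pos u; have p2 := Rabs_pos v; have p3 := Rabs_pos u'; have p4 := Rabs_pos v'.
have q1 : Rabs u * Rabs u' <= C * C' by apply: Rmult_le_compat.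
have q2 : Rabs v * Rabs v' <= C * C' by apply: Rmult_le_compat.
have q0 : 0 <= C * C' by apply: Rmult_le_pos; lra.
split; [rewrite Rabs_mult; lra | rewrite Rabs_mult; lra |].
have -> : u * u' - v * v' = u * (u' - v') + v' * (u - v) by ring.
apply: Rle_trans (Rabs_triang _ _) _; rewrite !Rabs_mult.
have r1 : Rabs u * Rabs (u' - v') <= C * (C' * d) by apply: Rmult_le_compat => //; exact: Rabs_pos.
have r2 : Rabs v' * Rabs (u - v) <= C' * (C * d) by apply: Rmult_le_compat => //; exact: Rabs_pos.
lra.
Qed.

Lemma near_opp C d u v : near C d u v -> near C d (- u) (- v).
Proof.
move=> [h1 h2 h3]; split; rewrite ?Rabs_Ropp //.
have -> : - u - - v = - (u - v) by ring.
by rewrite Rabs_Ropp.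
Qed.

Lemma near_cst d a : 0 <= d -> near (Rabs a) d a a.
Proof.
move=> d0; split; [lra | lra |]; rewrite Rminus_diag Rabs_R0.
by apply: Rmult_le_pos => //; exact: Rabs_pos.
Qed.

(* Indices above 3 repeat the last coordinate, so that no range condition is needed;
   [stat] follows the same convention. *)
Definition vf (i : nat) (u : nat -> R) : R :=
  match i with
  | 0 => gx (u 0%N)
  | 1 => g2 (u 0%N) (u 1%N)
  | 2 => g3 (u 0%N) (u 1%N) (u 2%N)
  | _ => g4 (u 0%N) (u 1%N) (u 2%N) (u 3%N)
  end.

(** Polynomials are bounded and Lipschitz on bounded sets; the sum of the four constants serves as a
    common one. *)
Lemma vf_near K : exists L, 1 <= L /\ forall d u v, 0 <= d ->
  (forall i, near K d (u i) (v i)) -> forall i, near L d (vf i u) (vf i v).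
Proof.
have ex i : exists L, forall d u v, 0 <= d ->
  (forall i, near K d (u i) (v i)) -> near L d (vf i u) (vf i v).
  (* The constant is an existential variable created before [d], [u], [v], hence independent of
     them; unification assembles it as the rules for [near] follow the polynomial. *)
  case: i => [|[|[|i]]]; eexists; intros d u v d0 h;
    rewrite /= /gx /g2 /g3 /g4 /Rminus /pow.
  all: repeat first [eapply near_opp | eapply near_add | eapply near_mul; [exact d0| |]
    | eapply h | eapply near_cst; exact d0].
have [L0 h0] := ex 0%N; have [L1 h1] := ex 1%N.
have [L2 h2] := ex 2%N; have [L3 h3] := ex 3%N.
exists (1 + Rabs L0 + Rabs L1 + Rabs L2 + Rabs L3).
have := Rabs_pos L0; have := Rabs_pos L1; have := Rabs_pos L2; have := Rabs_pos L3.
have := Rle_abs L0; have := Rle_abs L1; have := Rle_abs L2; have := Rle_abs L3.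
move=> *; split; first lra.
move=> d u v d0 h i.
case: i => [|[|[|i]]]; [apply: near_le (h0 _ _ _ d0 h) | apply: near_le (h1 _ _ _ d0 h)
  | apply: near_le (h2 _ _ _ d0 h) | apply: near_le (h3 _ _ _ d0 h)] => //; lra.
Qed.

Lemma exp_powE u k : exp u ^ k = exp (INR k * u).
Proof.
elim: k => [|k IH]; first by rewrite Rmult_0_l exp_0.
by rewrite S_INR Rmult_plus_distr_r Rmult_1_l exp_plus -IH /= Rmult_comm.
Qed.

Lemma exp_le_mono u v : u <= v -> exp u <= exp v.
Proof. by case=> [/exp_increasing/Rlt_le // | ->]; exact: Rle_refl. Qed.

(** * Convergence *)

Definition stat n (i : nat) (G : graph n) : R :=
  match i with 0 => xfrac G | 1 => smom 1 G | 2 => smom 2 G | _ => smom 3 G end.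

Definition sum4 (F : nat -> R) : R := F 0%N + F 1%N + F 2%N + F 3%N.

Lemma stat_nil n i : (1 < n)%N -> stat i ([::] : graph n) = 1.
Proof.
move=> n1; have N2 := INR_ge2 n1.
have hs k : smom k ([::] : graph n) = 1.
  rewrite -(smom0 n1 [::]) /smom !INR_tsum; congr Rdiv; apply: eq_bigr => v _.
  by rewrite isolated_csize //= pow1.
case: i => [|[|[|i]]] //=.
rewrite /xfrac /niso (_ : [set v | _] = setT) ?cardsT ?card_ord; first by field; lra.
by apply/setP => v; rewrite !inE.
Qed.

(** The square is expanded around y - z - dz. The 8 [eta] are: 1 for the second moment, 4 for the
    two drift errors (using |y - z| <= 1), 1 for N dz^2, and 2 for the cross term of dz with the
    mean increment. *)
Lemma step_error (T : finType) (Y' : T -> R) (N y z z' gy gz d L eta : R) :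
  (0 < #|T|)%N -> 0 < N -> L ^ 2 <= eta * N -> Rabs (y - z) <= 1 ->
  Rabs (N * avg (fun r => Y' r - y) - gy) <= eta ->
  N * avg (fun r => (Y' r - y) ^ 2) <= eta ->
  Rabs (N * (z' - z) - gz) <= eta -> Rabs (N * (z' - z)) <= L ->
  Rabs (gy - gz) <= L * d ->
  N * (avg (fun r => (Y' r - z') ^ 2) - (y - z) ^ 2) <= 2 * L * d * Rabs (y - z) + 8 * eta.
Proof.
move=> T0 N0 hL hyz h1 h2 h3 h4 h5.
set A1 := avg _ in h1; set A2 := avg _ in h2; set dz := z' - z in h3 h4.
have -> : avg (fun r => (Y' r - z') ^ 2) =
  A2 + (2 * (y - z - dz) * A1 + (y - z - dz) ^ 2).
  rewrite /A2 /A1 -avgZ -(avg_cst T0 ((y - z - dz) ^ 2)) -!avgD.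
  by apply: eq_avg => r; rewrite /dz; ring.
have e1 : N * (A2 + (2 * (y - z - dz) * A1 + (y - z - dz) ^ 2) - (y - z) ^ 2) =
  N * A2 + 2 * (y - z) * ((N * A1 - gy) - (N * dz - gz) + (gy - gz))
   + (N * dz ^ 2 - 2 * dz * (N * A1)) by ring.
(* AM-GM on the cross term [dz * A1], with [A1 ^ 2 <= A2] *)
have A12 : A1 ^ 2 <= A2.
  have : 0 <= avg (fun r => (Y' r - y - A1) ^ 2) by apply: avg_ge0 => // r; exact: pow2_ge_0.
  rewrite (@eq_avg _ _ (fun r => (Y' r - y) ^ 2 + (- 2 * A1 * (Y' r - y) + A1 ^ 2))); last first.
    by move=> r; ring.
  by rewrite avgD avgD avgZ avg_cst // -/A1 -/A2; lra.
have e2 : - 2 * dz * (N * A1) <= N * dz ^ 2 + N * A2.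
  have : 0 <= N * (dz + A1) ^ 2 by apply: Rmult_le_pos; [lra | exact: pow2_ge_0].
  have : N * A1 ^ 2 <= N * A2 by apply: Rmult_le_compat_l; lra.
  lra.
have e3 : N * dz ^ 2 <= eta.
  have e4 : (N * dz) ^ 2 <= L ^ 2.
    by rewrite -pow2_abs; apply: pow_incr; split => //; exact: Rabs_pos.
  apply: (Rmult_le_reg_r N) => //; apply: Rle_trans _ hL.
  by apply: Rle_trans _ e4; apply: Req_le; ring.
have e5 : (y - z) * ((N * A1 - gy) - (N * dz - gz) + (gy - gz)) <=
  Rabs (y - z) * (2 * eta + L * d).
  apply: Rle_trans (Rle_abs _) _; rewrite Rabs_mult; apply: Rmult_le_compat_l; first exact: Rabs_pos.
  apply: Rle_trans (Rabs_triang _ _) _; rewrite /Rminus.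
  have := Rabs_triang (N * A1 - gy) (- (N * dz - gz)); rewrite Rabs_Ropp /Rminus.
  by rewrite /Rminus in h1 h3 h5; lra.
rewrite e1; have := Rabs_pos (y - z) => p.
have eta0 : 0 <= eta by apply: Rle_trans h1; exact: Rabs_pos.
nra.
Qed.

Section Convergence.
Variables (z : nat -> R -> R) (tc T : R).
Hypothesis hT : 0 <= T < tc.
Hypothesis z_tail : forall i, z i.+3 = z 3%N.
Hypothesis z_init : forall i, z i 0 = 1.
Hypothesis z_right : forall i, right_cont_at (z i) 0.
Hypothesis z_der : forall i t, 0 < t < tc ->
  derivable_pt_lim (z i) t (vf i (fun k => z k t) / 2).

Lemma z_bounded : exists B, 0 <= B /\ forall i t, 0 <= t <= T -> Rabs (z i t) <= B.
Proof.
have [B0 h0] := sol_bounded (z_right 0) (z_der 0) hT.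
have [B1 h1] := sol_bounded (z_right 1) (z_der 1) hT.
have [B2 h2] := sol_bounded (z_right 2) (z_der 2) hT.
have [B3 h3] := sol_bounded (z_right 3) (z_der 3) hT.
exists (Rabs B0 + Rabs B1 + Rabs B2 + Rabs B3).
have := Rabs_pos B0; have := Rabs_pos B1; have := Rabs_pos B2; have := Rabs_pos B3.
have := Rle_abs B0; have := Rle_abs B1; have := Rle_abs B2; have := Rle_abs B3.
move=> *; split; first lra.
move=> [|[|[|i]]] t ht; [have := h0 t ht | have := h1 t ht | have := h2 t ht
  | rewrite (z_tail i); have := h3 t ht]; lra.
Qed.

(** A round lasts 2 / N and the ODE has right-hand side [vf] / 2, so N times the increment is [vf]
    at some intermediate time; moving that time back to [s] displaces [z] by at most 2 L / N and
    [vf] by at most 2 L^2 / N. *)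
Lemma flow_bounds : exists K L,
  [/\ 1 <= K, 1 <= L, forall i t, 0 <= t <= T -> Rabs (z i t) <= K - 1,
      forall d u v, 0 <= d -> (forall i, near K d (u i) (v i)) ->
        forall i, near L d (vf i u) (vf i v) &
      (forall i s t, 0 <= s <= t -> t <= T -> Rabs (z i t - z i s) <= L * (t - s)) /\
      (forall i s N, 0 <= s -> 0 < N -> s + 2 / N <= T ->
        Rabs (N * (z i (s + 2 / N) - z i s)) <= L /\
        Rabs (N * (z i (s + 2 / N) - z i s) - vf i (fun k => z k s)) <= 2 * L ^ 2 / N)].
Proof.
have [B [B0 hB]] := z_bounded.
(* The extra 1 is the room for a tube of radius 1 around the solution. *)
have [L [L1 hL]] := vf_near (B + 1).
exists (B + 1), L.
have hB' i t : 0 <= t <= T -> Rabs (z i t) <= B + 1.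
  by move=> ht; have := hB i t ht; lra.
have vb i t : 0 <= t <= T -> Rabs (vf i (fun k => z k t)) <= L.
  move=> ht.
  (* At distance 0 the relation [near] reduces to its bounds, and so yields a bound on [vf]. *)
  have h0 k : near (B + 1) 0 (z k t) (z k t).
    by split; rewrite ?Rminus_diag ?Rabs_R0 ?Rmult_0_r; auto; lra.
  by have [] := hL 0 (fun k => z k t) (fun k => z k t) (Rle_refl 0) h0 i.
have lip i s t : 0 <= s <= t -> t <= T -> Rabs (z i t - z i s) <= L * (t - s).
  move=> [s0 [st|<-]] tT; last by rewrite !Rminus_diag Rabs_R0; lra.
  have [xi [hxi ->]] := sol_mvt (z_right i) (z_der i) (conj s0 st) (Rle_lt_trans _ _ _ tT (proj2 hT)).
  rewrite Rabs_mult (Rabs_pos_eq (t - s)); last lra.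
  apply: Rmult_le_compat_r; first lra.
  rewrite /Rdiv Rabs_mult (Rabs_pos_eq (/ 2)); last lra.
  have hxi' : 0 <= xi <= T by lra.
  by have := vb i xi hxi'; have := Rabs_pos (vf i (fun k => z k xi)); lra.
split => //; [lra | by move=> i t ht; have := hB i t ht; lra |].
split => // i s N s0 N0 sT.
have h0 : 0 < 2 / N by apply: Rdiv_lt_0_compat; lra.
have ss : s < s + 2 / N by lra.
have [xi [hxi ->]] := sol_mvt (z_right i) (z_der i) (conj s0 ss) (Rle_lt_trans _ _ _ sT (proj2 hT)).
have -> : N * (vf i (fun k => z k xi) / 2 * (s + 2 / N - s)) = vf i (fun k => z k xi).
  by field; lra.
have hxi' : 0 <= xi <= T by lra.
split; first exact: vb.
have d0 : 0 <= L * (2 / N) by apply: Rmult_le_pos; lra.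
have hn k : near (B + 1) (L * (2 / N)) (z k xi) (z k s).
  split; [exact: hB' | apply: hB'; lra |].
  have sxi : 0 <= s <= xi by lra.
  apply: Rle_trans (lip k s xi sxi (proj2 hxi')) _.
  have : L * (xi - s) <= L * (2 / N) by apply: Rmult_le_compat_l; lra.
  by nra.
have [_ _] := hL _ _ _ d0 hn i.
have -> : L * (L * (2 / N)) = 2 * L ^ 2 / N by rewrite /Rdiv; ring.
by [].
Qed.

Definition tube_err n (j : nat) (G : graph n) : R :=
  sum4 (fun i => (stat i G - z i (2 * INR j / INR n)) ^ 2).

Lemma tube_err_ge0 n j (G : graph n) : 0 <= tube_err j G.
Proof. by rewrite /tube_err /sum4; repeat apply: Rplus_le_le_0_compat; exact: pow2_ge_0. Qed.

Lemma tube_err_coord n i j (G : graph n) :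
  (stat i G - z i (2 * INR j / INR n)) ^ 2 <= tube_err j G.
Proof.
have h k := pow2_ge_0 (stat k G - z k (2 * INR j / INR n)).
have := h 0%N; have := h 1%N; have := h 2%N; have := h 3%N; rewrite /tube_err /sum4.
by case: i => [|[|[|i]]]; rewrite ?(z_tail i) /=; lra.
Qed.

Lemma rounds_bounds n : INR (rounds n T) <= INR n * T / 2 < INR (rounds n T) + 1.
Proof.
have nT : 0 <= INR n * T / 2.
  by have := pos_INR n => ?; apply: Rmult_le_pos; [apply: Rmult_le_pos; lra | lra].
have [h1 h2] := base_Int_part (INR n * T / 2).
have Ip : (0 <= Int_part (INR n * T / 2))%Z.
  have : (-1 < Int_part (INR n * T / 2))%Z by apply: lt_IZR; lra.
  lia.
rewrite /rounds INR_IZR_INZ Z2Nat.id //; lra.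
Qed.

Lemma stat_drift K eta : 1 <= K -> 0 < eta ->
  exists N0 : nat, forall n (G : graph n), (N0 <= n)%N -> stat 3 G <= K ->
  forall i, drift_ok (@stat n i) G (vf i (fun k => stat k G)) eta.
Proof.
move=> K1 eta0; have [N0 h] := drift_all K1 eta0; exists N0 => n G nN hK i.
by have [? ? ? ?] := h n G nN hK; case: i => [|[|[|i]]].
Qed.

Lemma sqr_le1_abs (u : R) : u ^ 2 <= 1 -> Rabs u <= 1.
Proof. by move=> h; apply: Rabs_le; nra. Qed.

Lemma sum4_sqr (F : nat -> R) : sum4 F ^ 2 <= 4 * sum4 (fun i => F i ^ 2).
Proof.
rewrite /sum4.
have := pow2_ge_0 (F 0%N - F 1%N); have := pow2_ge_0 (F 0%N - F 2%N).
have := pow2_ge_0 (F 0%N - F 3%N); have := pow2_ge_0 (F 1%N - F 2%N).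
have := pow2_ge_0 (F 1%N - F 3%N); have := pow2_ge_0 (F 2%N - F 3%N).
lra.
Qed.

(** With d the l1 distance, the coordinate bounds 2 L d |delta_i| add up to 2 L d^2, and d^2 <= 4 D
    by Cauchy-Schwarz, whence 8 L. The four errors 8 [eta] give 32 [eta]. *)
Lemma tube_drift : exists L, 1 <= L /\ forall eta, 0 < eta ->
  exists N0 : nat, forall n, (N0 <= n)%N ->
  forall j (G : graph n), (j < rounds n T)%N -> tube_err j G <= 1 ->
  avg (fun r => tube_err j.+1 (bf_step G r)) <=
    (1 + 8 * L / INR n) * tube_err j G + 32 * eta / INR n.
Proof.
have [K [L [K1 L1 hK hL [_ hstep]]]] := flow_bounds.
exists L; split => // eta eta0.
have [N1 hN1] := stat_drift K1 eta0.
have [N2 hN2] := INR_unbounded (2 * L ^ 2 / eta).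
exists (maxn 2 (maxn N1 N2)) => n; rewrite !geq_max => /and3P [n2 nN1 nN2] j G jm hD.
have NN2 := INR_ge2 n2.
have Lbig : 2 * L ^ 2 <= eta * INR n.
  have : INR N2 <= INR n by apply: le_INR; apply/leP.
  move=> h; have h' : 2 * L ^ 2 / eta <= INR n by lra.
  have -> : 2 * L ^ 2 = eta * (2 * L ^ 2 / eta) by field; lra.
  by apply: Rmult_le_compat_l; lra.
set N := INR n in NN2 Lbig *.
set s := 2 * INR j / N.
have s0 : 0 <= s.
  apply: Rmult_le_pos; first by have := pos_INR j; lra.
  by apply: Rlt_le; apply: Rinv_0_lt_compat; lra.
have sE : s + 2 / N = 2 * INR j.+1 / N by rewrite /s S_INR; field; lra.
have sT : s + 2 / N <= T.
  rewrite sE; apply: (Rmult_le_reg_r N); first lra.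
  rewrite /Rdiv Rmult_assoc Rinv_l; last lra.
  have : INR j.+1 <= INR (rounds n T) by apply: le_INR; apply/leP.
  by have := rounds_bounds n; rewrite -/N; lra.
have sT' : 0 <= s <= T.
  by have : 0 < 2 / N by [apply: Rdiv_lt_0_compat; lra]; lra.
pose dl i := Rabs (stat i G - z i s).
have dl1 i : dl i <= 1.
  by apply: sqr_le1_abs; apply: Rle_trans (tube_err_coord i j G) hD.
have zb i := hK i s sT'.
have yb i : Rabs (stat i G) <= K.
  have := Rabs_triang (stat i G - z i s) (z i s).
  have -> : stat i G - z i s + z i s = stat i G by ring.
  by have := dl1 i; rewrite /dl; have := zb i; lra.
have y3 : stat 3 G <= K by have := Rle_abs (stat 3 G); have := yb 3%N; lra.
have dr := hN1 n G nN1 y3.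
pose d := sum4 dl.
have dl0 i : 0 <= dl i by exact: Rabs_pos.
have d0 : 0 <= d by rewrite /d /sum4; have := dl0 0%N; have := dl0 1%N; have := dl0 2%N; have := dl0 3%N; lra.
have dli i : dl i <= d.
  rewrite /d /sum4; have := dl0 0%N; have := dl0 1%N; have := dl0 2%N; have := dl0 3%N.
  case: i => [|[|[|i]]]; [lra | lra | lra |].
  by rewrite /dl z_tail /=; lra.
have hn i : near K d (stat i G) (z i s).
  split => //; first by have := zb i; lra.
  by apply: Rle_trans (dli i) _; nra.
have coord i : N * (avg (fun r => (stat i (bf_step G r) - z i (2 * INR j.+1 / N)) ^ 2)
    - (stat i G - z i s) ^ 2) <= 2 * L * d * dl i + 8 * eta.
  have N0 : 0 < N by lra.
  have [h1 h2] := dr i; have [h3 h4] := hstep i s N s0 N0 sT.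
  have [_ _ h5] := hL d _ _ d0 hn i.
  rewrite -sE; apply: (step_error (round_gt0 n2) N0 _ (dl1 i) h1 h2 _ h3 h5).
    by have := pow2_ge_0 L; lra.
  apply: Rle_trans h4 _; apply: (Rmult_le_reg_r N) => //.
  by rewrite /Rdiv Rmult_assoc Rinv_l; lra.
have -> : avg (fun r => tube_err j.+1 (bf_step G r)) =
  sum4 (fun i => avg (fun r => (stat i (bf_step G r) - z i (2 * INR j.+1 / N)) ^ 2)).
  by rewrite /sum4 -!avgD; apply: eq_avg.
have := coord 0%N; have := coord 1%N; have := coord 2%N; have := coord 3%N.
set A := (fun i : nat => _).
rewrite -/(A 0%N) -/(A 1%N) -/(A 2%N) -/(A 3%N) => c3 c2 c1 c0.
have DE : tube_err j G = sum4 (fun i => dl i ^ 2).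
  by rewrite /tube_err /sum4 /dl !pow2_abs.
have hd := sum4_sqr dl.
have hsum : N * (sum4 A - tube_err j G) <= 8 * L * tube_err j G + 32 * eta.
  have e1 : 2 * L * d * dl 0%N + 2 * L * d * dl 1%N + 2 * L * d * dl 2%N + 2 * L * d * dl 3%N
    = 2 * L * d ^ 2 by rewrite /d /sum4; ring.
  have e2 : 2 * L * d ^ 2 <= 8 * L * tube_err j G.
    rewrite DE; have : L * d ^ 2 <= L * (4 * sum4 (fun i => dl i ^ 2)).
      by apply: Rmult_le_compat_l => //; lra.
    lra.
  have e3 : N * (sum4 A - tube_err j G) = N * (A 0%N - (stat 0 G - z 0%N s) ^ 2)
    + N * (A 1%N - (stat 1 G - z 1%N s) ^ 2) + N * (A 2%N - (stat 2 G - z 2%N s) ^ 2)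
    + N * (A 3%N - (stat 3 G - z 3%N s) ^ 2) by rewrite /tube_err /sum4 -/N -/s; ring.
  lra.
apply: (Rmult_le_reg_l N); first lra.
have -> : N * ((1 + 8 * L / N) * tube_err j G + 32 * eta / N) =
  N * tube_err j G + (8 * L * tube_err j G + 32 * eta) by field; lra.
lra.
Qed.

Lemma tube_exit e eps : 0 < e <= 1 -> 0 < eps -> exists N0 : nat, forall n, (N0 <= n)%N ->
  exit_prob (@bf_step n) (@tube_err n) (rounds n T) e (rounds n T) [::] < eps.
Proof.
move=> [e0 e1] eps0; have [L [L1 hL]] := tube_drift.
(* It dominates (1 + 8 L / n)^m because m <= n T / 2. *)
pose E := exp (4 * L * T).
have E0 : 0 < E by exact: exp_pos.
(* This makes the final bound eps T / (T + 1); using T + 1 keeps it below eps and covers T = 0. *)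
pose eta := e * eps / (E * (16 * (T + 1))).
have T1 : 0 < E * (16 * (T + 1)) by apply: Rmult_lt_0_compat; lra.
have eta0 : 0 < eta.
  by apply: Rdiv_lt_0_compat => //; apply: Rmult_lt_0_compat.
have [N0 hN0] := hL eta eta0.
exists (maxn 2 N0) => n; rewrite geq_max => /andP [n2 nN0].
have NN2 := INR_ge2 n2.
set m := rounds n T.
have a1 : 1 <= 1 + 8 * L / INR n.
  by have : 0 < 8 * L / INR n by [apply: Rdiv_lt_0_compat; lra]; lra.
have c0 : 0 <= 32 * eta / INR n by apply: Rlt_le; apply: Rdiv_lt_0_compat; lra.
have := @exit_prob_bound _ _ (@bf_step n) (round_gt0 n2) (@tube_err n) m _ _ e
  (@tube_err_ge0 n) a1 c0 e0 _ m 0%N [::] (add0n m).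
(* In the empty graph all vertices are isolated and all components singletons, matching the initial
   value 1 in every coordinate. *)
have -> : tube_err 0 ([::] : graph n) = 0.
  have -> : tube_err 0 ([::] : graph n) = sum4 (fun=> 0).
    rewrite /tube_err /sum4 !stat_nil // [INR 0]/=.
    by rewrite Rmult_0_r /Rdiv Rmult_0_l !z_init; ring.
  by rewrite /sum4; ring.
move=> /(_ _)/Rle_lt_trans; apply.
  by move=> j G jm hD; apply: hN0 => //; lra.
have mb : INR m <= INR n * T / 2 := proj1 (rounds_bounds n).
have am : (1 + 8 * L / INR n) ^ m <= E.
  apply: (Rle_trans _ (exp (8 * L / INR n) ^ m)).
    by apply: pow_incr; split; [lra | exact: exp_ineq1_le].
  rewrite exp_powE; apply: exp_le_mono.
  have -> : 4 * L * T = 8 * L / INR n * (INR n * T / 2) by field; lra.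
  by rewrite Rmult_comm; apply: Rmult_le_compat_l => //; lra.
have mc : INR m * (32 * eta / INR n) <= 16 * eta * T.
  have -> : 16 * eta * T = INR n * T / 2 * (32 * eta / INR n) by field; lra.
  exact: Rmult_le_compat_r.
apply: (Rle_lt_trans _ (E * (16 * eta * T) / e)).
  apply: Rmult_le_compat_r; first by apply: Rlt_le; exact: Rinv_0_lt_compat.
  rewrite Rplus_0_l; apply: Rmult_le_compat => //; first by apply: pow_le; lra.
  by apply: Rmult_le_pos => //; exact: pos_INR.
have -> : E * (16 * eta * T) / e = eps * (T / (T + 1)).
  by rewrite /eta; field; lra.
have : T / (T + 1) < 1.
  apply: (Rmult_lt_reg_r (T + 1)); first lra.
  by rewrite /Rdiv Rmult_assoc Rinv_l; lra.
by nra.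
Qed.

(** The process stops at time 2 m / n, which lies within 2 / n before T; half of [eps] pays for this
    gap through the Lipschitz bound, the other half for leaving the tube. *)
Lemma conv_in_prob_coord i : (0 < i <= 3)%N -> conv_in_prob i.+1 (z i) T.
Proof.
move=> hi eps eps0 eps' eps'0.
have statE n (G : graph n) : s_k i.+1 G = stat i G.
  by rewrite s_kE; case: i hi => [|[|[|[|i]]]].
have [K [L [_ L1 _ _ [lip _]]]] := flow_bounds.
(* The tube radius is [e0 ^ 2], as [tube_err] is a squared distance; the minimum with 1 keeps it
   where the drift estimate holds. *)
pose e0 := Rmin (eps / 2) 1.
have e00 : 0 < e0 by apply: Rmin_glb_lt; lra.
have e0l : e0 <= eps / 2 by exact: Rmin_l.
have e01 : e0 <= 1 by exact: Rmin_r.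
have he : 0 < e0 ^ 2 <= 1 by nra.
have [N1 hN1] := tube_exit he eps'0.
have [N2 hN2] := INR_unbounded (4 * L / eps).
exists (maxn 2 (maxn N1 N2)) => n /leP; rewrite !geq_max => /and3P [n2 nN1 nN2].
have NN2 := INR_ge2 n2.
rewrite /R_dist Rminus_0_r Rabs_pos_eq; last first.
  apply: Rmult_le_pos; first exact: pos_INR.
  apply: Rlt_le; apply: Rinv_0_lt_compat; apply: lt_0_INR; apply/ltP.
  by rewrite cardsT card_ffun expn_gt0 round_gt0.
apply: Rle_lt_trans (hN1 n nN1).
apply: Rmult_le_compat_r.
  apply: Rlt_le; apply: Rinv_0_lt_compat; apply: lt_0_INR; apply/ltP.
  by rewrite cardsT card_ffun expn_gt0 round_gt0.
apply: le_INR; apply/leP; apply: subset_leq_card; apply/subsetP => om; rewrite !inE.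
rewrite {1}/Rltb; case: Rlt_dec => // + _; rewrite statE => hbad.
rewrite /Rltb; case: Rlt_dec => // hge; case: hge.
rewrite -/(BF om).
apply: Rlt_le_trans (tube_err_coord i _ _).
set m := rounds n T; set s := 2 * INR m / INR n.
have [m1 m2] := rounds_bounds n; rewrite -/m in m1 m2.
have sle : s <= T.
  apply: (Rmult_le_reg_r (INR n)); first lra.
  by rewrite /s /Rdiv Rmult_assoc Rinv_l; lra.
have s0 : 0 <= s.
  apply: Rmult_le_pos; first by have := pos_INR m; lra.
  by apply: Rlt_le; apply: Rinv_0_lt_compat; lra.
have sT : T - s <= 2 / INR n.
  apply: (Rmult_le_reg_r (INR n)); first lra.
  rewrite /s Rmult_minus_distr_r /Rdiv !Rmult_assoc Rinv_l; lra.
have := lip i s T (conj s0 sle) (Rle_refl _).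
have nb : L * (2 / INR n) <= eps / 2.
  have : INR N2 <= INR n by apply: le_INR; apply/leP.
  move=> h; have h' : 4 * L / eps <= INR n by lra.
  apply: (Rmult_le_reg_r (2 * INR n / eps)); first by apply: Rdiv_lt_0_compat; lra.
  have -> : L * (2 / INR n) * (2 * INR n / eps) = 4 * L / eps by field; lra.
  by have -> : eps / 2 * (2 * INR n / eps) = INR n by field; lra.
have : L * (T - s) <= L * (2 / INR n) by apply: Rmult_le_compat_l; lra.
move=> h1 h2.
have h3 : e0 < Rabs (stat i (BF om) - z i s).
  have := Rabs_triang (stat i (BF om) - z i s) (- (z i T - z i s)); rewrite Rabs_Ropp.
  have -> : stat i (BF om) - z i s + - (z i T - z i s) = stat i (BF om) - z i T by ring.
  lra.
rewrite -[X in _ < X]pow2_abs; move: (Rabs _) h3 => r h3; nra.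
Qed.

End Convergence.

Theorem theorem3p2 (x s2 s3 s4 : R -> R) (tc : R)
  (hx0 : x 0 = 1)
  (hxd : forall t, 0 < t -> derivable_pt_lim x t (- x t ^ 2 - (1 - x t ^ 2) * x t))
  (hxc : right_cont_at x 0)
  (hxpos : forall t, 0 <= t -> 0 < x t)
  (htc : 0 < tc)
  (h20 : s2 0 = 1) (h30 : s3 0 = 1) (h40 : s4 0 = 1)
  (h2d : forall t, 0 < t < tc ->
     derivable_pt_lim s2 t (x t ^ 2 + (1 - x t ^ 2) * s2 t ^ 2))
  (h3d : forall t, 0 < t < tc ->
     derivable_pt_lim s3 t (3 * x t ^ 2 + 3 * (1 - x t ^ 2) * s2 t * s3 t))
  (h4d : forall t, 0 < t < tc ->
     derivable_pt_lim s4 t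
       (7 * x t ^ 2 + (1 - x t ^ 2) * (4 * s2 t * s4 t + 3 * s3 t ^ 2)))
  (h2c : right_cont_at s2 0) (h3c : right_cont_at s3 0) (h4c : right_cont_at s4 0)
  (hblow : forall M : R, exists d : R, 0 < d /\
     forall t, tc - d < t < tc -> M < s2 t)
  (t : R) (ht : 0 <= t < tc) :
  conv_in_prob 2 s2 t /\ conv_in_prob 3 s3 t /\ conv_in_prob 4 s4 t.
Proof.
pose z i := match i with 0 => x | 1 => s2 | 2 => s3 | _ => s4 end.
have z_tail i : z i.+3 = z 3%N by [].
have z_init i : z i 0 = 1 by case: i => [|[|[|i]]].
have z_right i : right_cont_at (z i) 0 by case: i => [|[|[|i]]].
have z_der i u : 0 < u < tc -> derivable_pt_lim (z i) u (vf i (fun k => z k u) / 2).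
  move=> hu; case: i => [|[|[|i]]] /=.
  - have -> : gx (x u) / 2 = - x u ^ 2 - (1 - x u ^ 2) * x u by rewrite /gx; field.
    by apply: hxd; lra.
  - have -> : g2 (x u) (s2 u) / 2 = x u ^ 2 + (1 - x u ^ 2) * s2 u ^ 2 by rewrite /g2; field.
    exact: h2d.
  - have -> : g3 (x u) (s2 u) (s3 u) / 2 =
      3 * x u ^ 2 + 3 * (1 - x u ^ 2) * s2 u * s3 u by rewrite /g3; field.
    exact: h3d.
  have -> : g4 (x u) (s2 u) (s3 u) (s4 u) / 2 =
    7 * x u ^ 2 + (1 - x u ^ 2) * (4 * s2 u * s4 u + 3 * s3 u ^ 2) by rewrite /g4; field.
  exact: h4d.
have conv i := @conv_in_prob_coord z tc t ht z_tail z_init z_right z_der i.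
by split; [exact: (conv 1%N) | split; [exact: (conv 2%N) | exact: (conv 3%N)]].
Qed.
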